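(* Let $X$ be a compact Riemannian $2$-manifold (with boundary), equipped with a Riemannian metric $g$ and with the corresponding intrinsic metric $d_g$. Let $d_X$ be another metric on $X$ that induces its topology. The following are quantitatively equivalent. (1) The metric space $(X,d_g)$ is quasisymmetric to $(X,d_X)$. (2) For each $k\in\mathbb N$ there exist a Riemannian metric $g_k$ on $X$ and a metric $d_k$ on $X$ that is locally isometric to the intrinsic metric $d_{g_k}$ such that $(X,d_k)$ converges to $(X,d_X)$ in the Gromov--Hausdorff metric as $k\to\infty$, and $(X,d_k)$ is uniformly quasisymmetric to $(X,d_g)$ for each $k\in\mathbb N$. In this case there exists an approximately isometric sequence $f_k\colon(X,d_k)\to(X,d_X)$, $k\in\mathbb N$, of uniform quasisymmetries.
   Context: The boundary of $X$ may be empty, and $X$ is connected so that $d_g$ is a finite metric. A homeomorphism $f\colon (X,d_X)\to (Y,d_Y)$ is $\eta$-quasisymmetric, for a homeomorphism $\eta\colon[0,\infty)\to[0,\infty)$ (a distortion function), if $\frac{d_Y(f(x),f(y))}{d_Y(f(x),f(z))}\le\eta\left(\frac{d_X(x,y)}{d_X(x,z)}\right)$ for all distinct $x,y,z\in X$. Two spaces are quasisymmetric if there is an $\eta$-quasisymmetric homeomorphism between them for some $\eta$. ''Uniformly quasisymmetric'' / ''uniform quasisymmetries'' means that the homeomorphisms can be taken (resp. are) $\eta'$-quasisymmetric with a distortion function $\eta'$ independent of $k$. A metric $d$ on $X$ is locally isometric to $d_{g}$ if the identity map $(X,d_{g})\to(X,d)$ is a local isometry: for every $x\in X$ there is $r>0$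 such that the identity restricts to an isometric homeomorphism from the ball $B_{d_g}(x,r)$ onto the ball $B_{d}(x,r)$. A map $f\colon Y\to Z$ between metric spaces is an $\varepsilon$-isometry if every point of $Z$ has distance less than $\varepsilon$ from $f(Y)$ and $|d_Y(x,y)-d_Z(f(x),f(y))|<\varepsilon$ for all $x,y\in Y$. A sequence $f_k\colon X_k\to Z$ is approximately isometric if $f_k$ is an $\varepsilon_k$-isometry with $\varepsilon_k>0$, $\varepsilon_k\to0$. ''Quantitatively equivalent'' means that (1) and (2) are equivalent and the distortion function in each can be chosen depending only on the distortion function in the other (and not on $X$, $g$, $d_X$). *)

(* Defs.v *)
From HB Require Import structures.
From mathcomp Require Import all_boot all_order all_algebra.
From mathcomp Require Import all_classical all_reals all_analysis.

Set Implicit Arguments.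
Unset Strict Implicit.
Unset Printing Implicit Defensive.

Import Order.TTheory GRing.Theory Num.Theory.
Import numFieldNormedType.Exports.

Local Open Scope classical_set_scope.
Local Open Scope ring_scope.

(* Metrics are plain functions [T -> T -> R] rather than [metricType]
   structures: a single space carries several of them here, and the intrinsic
   metric of a Riemannian metric is defined before it is shown to be one. *)

Section metric_notions.
Context {R : realType}.
Implicit Types X Y Z : Type.

Definition is_metric X (d : X -> X -> R) : Prop :=
  [/\ forall x y, d x y = 0 <-> x = y,
      forall x y, d x y = d y x
    & forall x y z, d x z <= d x y + d y z].

Definition dball X (d : X -> X -> R) (x : X) (r : R) : set X :=
  [set y | d x y < r].

Definition induces_topology (X : topologicalType) (d : X -> X -> R) : Prop :=
  forall (x : X) (A : set X),
    nbhs x A <-> exists2 r : R, 0 < r & dball d x r `<=` A.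

Definition dcontinuous X Y (dX : X -> X -> R) (dY : Y -> Y -> R)
    (f : X -> Y) : Prop :=
  forall x (e : R), 0 < e ->
    exists2 r : R, 0 < r & f @` dball dX x r `<=` dball dY (f x) e.

Definition dhomeomorphism X Y (dX : X -> X -> R) (dY : Y -> Y -> R)
    (f : X -> Y) : Prop :=
  exists h : Y -> X,
    [/\ cancel f h, cancel h f, dcontinuous dX dY f & dcontinuous dY dX h].

Definition homeo_on (T U : topologicalType) (A : set T) (B : set U)
    (f : T -> U) (h : U -> T) : Prop :=
  [/\ set_fun A B f, set_fun B A h,
      {in A, cancel f h}, {in B, cancel h f}
    & {within A, continuous f} /\ {within B, continuous h}].

(* Only the values of [eta] on the half-line matter. *)
Definition distortion_function (eta : R -> R) : Prop :=
  exists theta : R -> R,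
    homeo_on [set t : R | 0 <= t] [set t : R | 0 <= t] eta theta.

Definition quasisymmetry X Y (eta : R -> R)
    (dX : X -> X -> R) (dY : Y -> Y -> R) (f : X -> Y) : Prop :=
  dhomeomorphism dX dY f /\
  forall x y z, x <> y -> x <> z -> y <> z ->
    dY (f x) (f y) / dY (f x) (f z) <= eta (dX x y / dX x z).

Definition quasisymmetric_to X Y (eta : R -> R)
    (dX : X -> X -> R) (dY : Y -> Y -> R) : Prop :=
  exists f : X -> Y, quasisymmetry eta dX dY f.

Definition locally_isometric X (d0 d : X -> X -> R) : Prop :=
  forall x, exists2 r : R, 0 < r &
    dball d0 x r = dball d x r /\
    forall y z, dball d0 x r y -> dball d0 x r z -> d y z = d0 y z.

Definition eps_isometry Y Z (e : R) (dY : Y -> Y -> R) (dZ : Z -> Z -> R)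
    (f : Y -> Z) : Prop :=
  (forall z, exists y, dZ z (f y) < e) /\
  (forall x y, `|dY x y - dZ (f x) (f y)| < e).

Definition approximately_isometric X Z (d : nat -> X -> X -> R)
    (dZ : Z -> Z -> R) (f : nat -> X -> Z) : Prop :=
  exists e : nat -> R,
    [/\ forall k, 0 < e k, e @ \oo --> (0 : R)
      & forall k, eps_isometry (e k) (d k) dZ (f k)].

Definition hausdorff_distance Z (d : Z -> Z -> R) (A B : set Z) : \bar R :=
  ereal_inf [set r%:E | r in [set r : R |
    [/\ 0 < r, forall a, A a -> exists2 b, B b & d a b < r
      & forall b, B b -> exists2 a, A a & d b a < r]]].

Definition gromov_hausdorff_distance X Y (dX : X -> X -> R) (dY : Y -> Y -> R)
    : \bar R :=
  ereal_inf [set D | exists (Z : Type) (dZ : Z -> Z -> R)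
                            (i : X -> Z) (j : Y -> Z),
    [/\ is_metric dZ,
        forall x x', dZ (i x) (i x') = dX x x',
        forall y y', dZ (j y) (j y') = dY y y'
      & D = hausdorff_distance dZ (range i) (range j)]].

End metric_notions.

Section differentiability.
Context {R : realType}.

Fixpoint Ck (V W : normedModType R) (n : nat) (O : set V) (f : V -> W)
    : Prop :=
  match n with
  | 0 => forall p, O p -> {for p, continuous f}
  | m.+1 => (forall p, O p -> differentiable f p) /\
            forall v, Ck m O (fun p => 'D_v f p)
  end.

Definition smooth (V W : normedModType R) (O : set V) (f : V -> W) : Prop :=
  forall n, Ck n O f.

Definition local_extension (V W : normedModType R) (S : set V) (f : V -> W)
    (p : V) (O : set V) (F : V -> W) : Prop :=
  [/\ open O, O p & forall q, O q -> S q -> F q = f q].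

(* On a set that need not be open (a relatively open subset of the half-plane,
   a closed interval), differentiability means that of local extensions. *)
Definition Ck_on (V W : normedModType R) (n : nat) (S : set V) (f : V -> W)
    : Prop :=
  forall p, S p -> exists O F, local_extension S f p O F /\ Ck n O F.

Definition smooth_on (V W : normedModType R) (S : set V) (f : V -> W) : Prop :=
  forall p, S p -> exists O F, local_extension S f p O F /\ smooth O F.

End differentiability.

Section surfaces.
Context {R : realType}.

Definition half_plane : set 'rV[R]_2 := [set p | 0 <= p ord0 ord_max].

Record chart (X : topologicalType) := Chart {
  chart_dom : set X;
  chart_img : set 'rV[R]_2;
  chart_map : X -> 'rV[R]_2;
  chart_inv : 'rV[R]_2 -> X;
  chart_dom_open : open chart_dom;
  chart_img_open : exists2 O, open O & chart_img = O `&` half_plane;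
  chart_homeo : homeo_on chart_dom chart_img chart_map chart_inv }.

Definition overlap (X : topologicalType) (a b : chart X) : set 'rV[R]_2 :=
  chart_map a @` (chart_dom a `&` chart_dom b).

Definition transition (X : topologicalType) (a b : chart X)
    : 'rV[R]_2 -> 'rV[R]_2 :=
  chart_map b \o chart_inv a.

(* Smooth 2-manifolds with (possibly empty) boundary. [chart_at] selects a
   chart around each point; curve lengths do not depend on the selection. *)
Record smooth_surface (X : topologicalType) := SmoothSurface {
  atlas : set (chart X);
  chart_at : X -> chart X;
  surface_hausdorff : hausdorff_space X;
  surface_second_countable : @second_countable X;
  chart_at_atlas : forall x, atlas (chart_at x);
  chart_at_dom : forall x, chart_dom (chart_at x) x;
  atlas_compatible : forall a b, atlas a -> atlas b ->
    smooth_on (overlap a b) (transition a b) }.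

(* [rm_coef a p] is the Gram matrix at [p] of the coordinate frame of the
   chart [a]. The Jacobian acts on row vectors on the right,
   ['D_v F p = v *m 'J F p]; it does not depend on the extension [F]. *)
Record riemannian_metric (X : topologicalType) (M : smooth_surface X) :=
  RiemannianMetric {
  rm_coef : chart X -> 'rV[R]_2 -> 'M[R]_2;
  rm_smooth : forall a, atlas M a -> smooth_on (chart_img a) (rm_coef a);
  rm_sym : forall a p, atlas M a -> chart_img a p ->
    (rm_coef a p)^T = rm_coef a p;
  rm_posdef : forall a p (v : 'rV[R]_2), atlas M a -> chart_img a p ->
    v != 0 -> 0 < (v *m rm_coef a p *m v^T) ord0 ord0;
  rm_change : forall a b x O F, atlas M a -> atlas M b ->
    chart_dom a x -> chart_dom b x ->
    local_extension (overlap a b) (transition a b) (chart_map a x) O F ->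
    smooth O F ->
    rm_coef a (chart_map a x) =
      'J F (chart_map a x) *m rm_coef b (chart_map b x)
        *m ('J F (chart_map a x))^T }.

Definition C1_curve (X : topologicalType) (M : smooth_surface X)
    (I : set R) (c : R -> X) : Prop :=
  forall a, atlas M a ->
    @Ck_on R R 'rV[R]_2 1 (I `&` c @^-1` chart_dom a) (chart_map a \o c).

Definition piecewise_C1_curve (X : topologicalType) (M : smooth_surface X)
    (c : R -> X) : Prop :=
  {within `[0, 1], continuous c} /\
  exists (n : nat) (t : nat -> R),
    [/\ t 0%N = 0, t n = 1
      & forall i, (i < n)%N ->
          t i < t i.+1 /\ C1_curve M `[t i, t i.+1] c].

Definition speed (X : topologicalType) (M : smooth_surface X)
    (g : riemannian_metric M) (c : R -> X) (t : R) : R :=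
  let a := chart_at M (c t) in
  let v := derive1 (chart_map a \o c) t in
  Num.sqrt ((v *m rm_coef g a (chart_map a (c t)) *m v^T) ord0 ord0).

Definition curve_length (X : topologicalType) (M : smooth_surface X)
    (g : riemannian_metric M) (c : R -> X) : \bar R :=
  (\int[lebesgue_measure]_(t in `[0%R, 1%R]) (speed g c t)%:E)%E.

Definition intrinsic_metric (X : topologicalType) (M : smooth_surface X)
    (g : riemannian_metric M) (x y : X) : R :=
  fine (ereal_inf [set curve_length g c | c in [set c : R -> X |
    [/\ piecewise_C1_curve M c, c 0 = x & c 1 = y]]]).

Definition uniform_approximation (X : topologicalType) (M : smooth_surface X)
    (g : riemannian_metric M) (dX : X -> X -> R) (eta : R -> R)
    (gs : nat -> riemannian_metric M) (ds : nat -> X -> X -> R) : Prop :=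
  [/\ forall k, is_metric (ds k),
      forall k, locally_isometric (intrinsic_metric (gs k)) (ds k),
      gromov_hausdorff_distance (ds k) dX @[k --> \oo] --> 0%E
    & forall k, quasisymmetric_to eta (ds k) (intrinsic_metric g)].

End surfaces.

(* Main.v *)
Require Import Defs.
From HB Require Import structures.
From mathcomp Require Import all_boot all_order all_algebra.
From mathcomp Require Import all_classical all_reals all_analysis.
From mathcomp Require Import measurable_realfun.
From mathcomp Require Import ring lra zify.

Set Implicit Arguments.
Unset Strict Implicit.
Unset Printing Implicit Defensive.

Import Order.TTheory GRing.Theory Num.Theory.
Import numFieldNormedType.Exports.

Local Open Scope classical_set_scope.
Local Open Scope ring_scope.

(** From a quasisymmetry of [e = d_g] onto [d_X] to approximations: pull [d_X]
    back to a metric [d] on [X]. The metrics [g_k] are constant multiples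
    [c^2 g], with [c] huge. For a small exponent [1/n], depending only on the
    distortion, the snowflake [p = 8 delta (d / delta)^(1/n)] makes
    [min (c e, p)] a quasimetric with constant [2], so by Frink's lemma the
    largest metric [b] below it is comparable to it; since [p] decays more
    slowly than [e], [b] equals [c e] at small scales. To follow [d] at scales
    above [delta] as well, [b] is replaced by its maximum with a pseudometric
    close to [d] and, below scale [delta / 2], at most [b]. The result is
    uniformly comparable to [min (c e, d + p)], hence uniformly quasisymmetric
    to [e], and tends to [d] as [delta] tends to [0].

    Conversely, transport the metrics [d_k] to [(X, d_g)] by the given
    quasisymmetries. They are equicontinuous, and along a free ultrafilter the
    Gromov-Hausdorff approximations converge to a quasisymmetry
    [F : (X, d_g) -> (X, d_X)] along which they are uniformly close to [d_X].
    As this holds for every free ultrafilter, nearly optimal choices of [F] for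
    each [k] give the approximately isometric sequence.

    Of the Riemannian structure one needs only that [d_g] is a metric, scales
    with [g], and is continuous for the topology of [X]. *)

(** * Integrals of nonnegative functions *)

(** Uniform distortion comes from the fact that the ratios of [c * e], of [d] and of [p] are each
    bounded in terms of the ratio of [e] alone: [c] and [delta] cancel, so they may depend on [d] in
    any way. Local isometry is asked only at some positive scale, free to shrink with [k]; hence
    multiples of [g] suffice, with [c] as large as one likes.

    Two demands fix [n]. Taking the root turns the doubling constant [1 + H 1 <= 2 ^+ n] of [d] into
    the constant [2] of Frink's lemma. And doubling a distance [e] multiplies [d] by at most
    [K = H 2], so [d] is bounded below by a constant times the power of [e] with exponent log2 of
    [K]; as [K ^+ 2 <= 2 ^+ n], the root of [d] is at least of the order of the square root of [e],
    and this beats every multiple of [e] at small scales.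

    The ratio estimate compares the new metric with [e], while the approximations require
    quasisymmetries onto [e]; so the distortion has to be inverted. In the converse the limit [F]
    depends on the ultrafilter, so no single [F] is close to all the [d_k], and one has to be chosen
    for each [k]. *)

Section lower_integral.
Context {R : realType}.
Local Open Scope ereal_scope.
Local Notation mu := (@lebesgue_measure R).
Import HBNNSimple.

Definition affine_map (a b : R) (t : measurableTypeR R) : measurableTypeR R :=
  (a * t + b)%R.

Lemma measurable_affine_map (a b : R) :
  measurable_fun [set: measurableTypeR R] (affine_map a b).
Proof. exact: measurable_funD. Qed.

(** By uniqueness of Lebesgue measure it is enough to test half-open intervals. A negative [a] moves
    the closed end to the other side, hence the two cases. *)
Lemma lebesgue_measure_affine (a b : R) (A : set (measurableTypeR R)) :
  a != 0%R -> measurable A ->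
  `|a|%:E * pushforward mu (affine_map a b) A = mu A.
Proof.
move=> a0 mA.
have a0' : (0 <= `|a|)%R by [].
pose m1 : measure (measurableTypeR R) R := pushforward mu (affine_map a b).
pose m2 : measure (measurableTypeR R) R :=
  mscale (NngNum a0') (m1 (@measurable_affine_map a b)).
apply/esym; apply: (@lebesgue_measure_unique R m2) => // _ [[x y]] _ <-.
rewrite /m2 /m1 /= /mscale /= /pushforward /affine_map /=.
have [agt|alt|a00] := ltgtP a 0%R; last by rewrite a00 eqxx in a0.
- have -> : (fun t : measurableTypeR R => (a * t + b)%R : measurableTypeR R) @^-1` `]x%R, y%R]
      = `[((y - b) / a)%R, ((x - b) / a)%R[%classic.
    by apply/seteqP; split => t /=; rewrite !in_itv /=
      ler_ndivrMr// ltr_ndivlMr// ltrBlDr lerBrDr mulrC => /andP[-> ->].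
  rewrite !lebesgue_measure_itv /= !lte_fin ltr_nM2r ?invr_lt0// ltrD2r.
  case: ifPn => xy; rewrite ?mule0// -!EFinB -EFinM; congr EFin.
  by rewrite ltr0_norm//; field; rewrite lt_eqF.
- have -> : (fun t : measurableTypeR R => (a * t + b)%R : measurableTypeR R) @^-1` `]x%R, y%R]
      = `]((x - b) / a)%R, ((y - b) / a)%R]%classic.
    by apply/seteqP; split => t /=; rewrite !in_itv /=
      ltr_pdivrMr// ler_pdivlMr// ltrBlDr lerBrDr mulrC => /andP[-> ->].
  rewrite !lebesgue_measure_itv /= !lte_fin ltr_pM2r ?invr_gt0// ltrD2r.
  case: ifPn => xy; rewrite ?mule0// -!EFinB -EFinM; congr EFin.
  by rewrite gtr0_norm//; field; rewrite gt_eqF.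
Qed.

Lemma ge0_integral_affine (a b : R) (h : R -> \bar R) :
  a != 0%R -> measurable_fun [set: measurableTypeR R] h ->
  (forall t, 0 <= h t) ->
  `|a|%:E * \int[mu]_t h (a * t + b)%R = \int[mu]_t h t.
Proof.
move=> a0 mh h0.
have mA := @measurable_affine_map a b.
rewrite -[X in _ * integral _ X _](preimage_setT (affine_map a b)).
rewrite -[X in _ * X](ge0_integral_pushforward mA mu measurableT mh) => [|//].
have a0' : (0 <= `|a|)%R by [].
pose m1 : measure (measurableTypeR R) R := pushforward mu (affine_map a b).
rewrite -(@ge0_integral_mscale _ _ _ (m1 mA) _ measurableT (NngNum a0') h mh) //.
by apply: eq_measure_integral => A mS _; exact: lebesgue_measure_affine.
Qed.

(** The integral of a nonnegative function is a supremum over the simple functions below it, and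
    this supremum is monotone for arbitrary functions. *)
Lemma le_integral_nonmeasurable (f g : R -> \bar R) (D E : set R) :
  (forall t, 0 <= f t) -> (forall t, 0 <= g t) ->
  (forall t, D t -> E t /\ f t <= g t \/ f t = 0) ->
  \int[mu]_(t in D) f t <= \int[mu]_(t in E) g t.
Proof.
move=> f0 g0 fg; rewrite !ge0_integralE//.
apply: le_ereal_sup => _ [h /= hf <-]; exists h => //= t.
apply: le_trans (hf t) _; rewrite !patchE.
case: ifPn => [/set_mem/fg[[Et fgt]|->]|_]; first by rewrite mem_set.
all: by case: ifPn.
Qed.

(* The speed of a curve, defined through a selection of charts, is not obviously
   measurable; but the integral of any nonnegative function is a supremum over
   the simple functions below it, which are. *)
Lemma integral_le_simple (f : R -> \bar R) (D : set R) (B : \bar R) :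
  (forall t, 0 <= f t) ->
  (forall h : R -> R, measurable_fun [set: measurableTypeR R] h ->
     (forall t, (0 <= h t)%R) -> (forall t, D t -> (h t)%:E <= f t) ->
     (forall t, ~ D t -> h t = 0%R) ->
     \int[mu]_t (h t)%:E <= B) ->
  \int[mu]_(t in D) f t <= B.
Proof.
move=> f0 H; rewrite ge0_integralE//.
apply: ge_ereal_sup => _ [h /= hf <-].
have -> : sintegral mu h = \int[mu]_t (h t)%:E.
  by rewrite integral_nnsfun// patch_setT.
apply: H => [|t|t Dt|t Dt].
- exact: measurable_funP.
- by rewrite fun_ge0.
- by apply: le_trans (hf t) _; rewrite patchE mem_set.
- apply/eqP; rewrite eq_le fun_ge0 andbT -lee_fin.
  by apply: le_trans (hf t) _; rewrite patchE memNset.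
Qed.

(** The change of variables is made in a simple function [h] below [f], where it is an equality; for
    [f] itself an inequality is left. *)
Lemma le_integral_affine (a b : R) (f g : R -> \bar R) (D E : set R) :
  a != 0%R -> (forall t, 0 <= f t) -> (forall t, 0 <= g t) ->
  (forall t, D t -> E (a * t + b)%R /\ f t <= `|a|%:E * g (a * t + b)%R) ->
  \int[mu]_(t in D) f t <= \int[mu]_(t in E) g t.
Proof.
move=> a0 f0 g0 fg; apply: integral_le_simple => // h mh h0 hf hD.
have na0 : (`|a| != 0)%R by rewrite normr_eq0.
have ia0 : (a^-1 != 0)%R by rewrite invr_eq0.
have mhA : measurable_fun [set: measurableTypeR R]
    (fun s : R => (h (a^-1 * s + (- (a^-1 * b))))%R%:E).
  apply/measurable_EFinP; apply: (@measurableT_comp _ _ _ _ _ _ h) => //.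
  exact: measurable_affine_map.
rewrite -(ge0_integral_affine (- (a^-1 * b)) ia0); last 2 first.
- exact/measurable_EFinP.
- by move=> t; rewrite lee_fin.
rewrite -ge0_integralZl_EFin//; last by move=> t _; rewrite lee_fin.
apply: le_integral_nonmeasurable => // t.
  by rewrite -EFinM lee_fin mulr_ge0.
move=> _; set s := (_ + _)%R.
have -> : t = (a * s + b)%R by rewrite /s; field.
have [Ds|/hD ->] := pselect (D s); last by right; rewrite mule0.
left; have [Es le] := fg s Ds; split=> //.
have := le_trans (hf s Ds) le.
case: (g _) (g0 (a * s + b)%R) => [r r0| |//].
  rewrite -!EFinM !lee_fin normfV => hs.
  by rewrite ler_pdivrMl// normr_gt0.
by move=> _ _; rewrite leey.
Qed.

End lower_integral.

(** * Curves under affine reparametrisation *)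

Section negligible.
Context {R : realType}.
Local Open Scope ereal_scope.
Local Notation mu := (@lebesgue_measure R).

Lemma integral_le_finite_setD (f : R -> \bar R) (D N : set R) :
  finite_set N -> (forall t, 0 <= f t) ->
  \int[mu]_(t in D) f t <= \int[mu]_(t in D `\` N) f t.
Proof.
move=> finN f0; apply: integral_le_simple => // h mh h0 hf hD.
have N0 : mu N = 0 by apply: countable_lebesgue_measure0; exact: finite_set_countable.
have mN : measurable (N : set (measurableTypeR R)).
  exact/countable_measurable/finite_set_countable.
rewrite (ge0_negligible_integral mN measurableT) //; last 2 first.
- exact/measurable_EFinP.
- by move=> t _; rewrite lee_fin.
apply: le_integral_nonmeasurable => // t [_ Nt].
have [Dt|/hD ->] := pselect (D t); last by right.
by left; split=> //; exact: hf.
Qed.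

End negligible.

Section affine_composition.
Context {R : realType} {V W : normedModType R}.
Implicit Types (F : V -> W) (u p : V).

(** Serves both as an affine change of parameter, for [V = R], and as a straight segment in the
    image of a chart. *)
Definition line u p (t : R) : V := t *: u + p.

Lemma line_continuous u p : continuous (line u p).
Proof.
move=> t; apply: cvgD; last exact: cvg_cst.
by apply: cvgZr_tmp.
Qed.

Lemma is_diff_line u p (t : R) :
  is_diff t (line u p) ( *:%R^~ u : R -> V).
Proof.
have d1 : is_diff t ( *:%R^~ u : R -> V) ( *:%R^~ u) := is_diff_scalel t u.
have d2 : is_diff t (cst p : R -> V) 0 := is_diff_cst p t.
by have := is_diffD d1 d2; rewrite addr0.
Qed.

Lemma differentiable_line u p t : differentiable (line u p) t.
Proof. by have [] := is_diff_line u p t. Qed.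

Lemma derive_comp_line F u p (t v : R) : differentiable F (line u p t) ->
  'D_v (F \o line u p) t = 'D_(v *: u) F (line u p t).
Proof.
move=> dF; have dl := differentiable_line u p t.
rewrite !deriveE//; last exact: differentiable_comp.
rewrite diff_comp//=; congr ('d F _ _).
by have [_ ->] := is_diff_line u p t.
Qed.

Lemma Ck1_comp_line F O u p : open O -> Ck 1 O F ->
  Ck 1 (line u p @^-1` O) (F \o line u p).
Proof.
move=> oO [dF cF]; split=> [t Ot|v t Ot].
  by apply: differentiable_comp; [exact: differentiable_line|exact: dF].
have near_eq : \forall s \near t,
    'D_(v *: u) F (line u p s) = 'D_v (F \o line u p) s.
  have /open_nbhs_nbhs : open_nbhs t (line u p @^-1` O).
    by split => //; apply: open_comp => // s _; exact: line_continuous.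
  by apply: filterS => s Os; rewrite derive_comp_line//; exact: dF.
rewrite /prop_for /continuous_at derive_comp_line; last exact: dF.
apply: cvg_trans (near_eq_cvg near_eq) _.
exact: (continuous_comp (@line_continuous u p t) (cF _ _ Ot)).
Qed.

End affine_composition.

Section le_integral_setU.
Context {R : realType}.
Local Open Scope ereal_scope.
Local Notation mu := (@lebesgue_measure R).

(** The splitting is additivity for the simple functions below [f]. *)
Lemma le_integral_split (f : R -> \bar R) (D A : set R) :
  measurable (A : set (measurableTypeR R)) -> (forall t, 0 <= f t) ->
  \int[mu]_(t in D) f t <=
    \int[mu]_(t in D `&` A) f t + \int[mu]_(t in D `\` A) f t.
Proof.
move=> mA f0; apply: integral_le_simple => // h mh h0 hf hD.
have mB := measurableC mA.
rewrite -(setUv A) ge0_integral_setU//; last 3 first.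
- by rewrite setUv; exact/measurable_EFinP.
- by move=> t _; rewrite lee_fin.
- by rewrite disj_set2E setICr.
apply: leeD; apply: le_integral_nonmeasurable => // t At;
  (have [Dt|/hD ->] := pselect (D t); last by right);
  by left; split=> //; exact: hf.
Qed.

End le_integral_setU.

Section curves.
Context {R : realType} {X : topologicalType} (M : smooth_surface (R := R) X).
Implicit Types (c : R -> X) (I J : set R) (a b : R).

Lemma C1_curve_line I J c c' a b :
  (forall t, J t -> I (line a b t) /\ c' t = c (line a b t)) ->
  C1_curve M I c -> C1_curve M J c'.
Proof.
move=> JI cC1 k kA t [Jt dt]; have [It cc't] := JI t Jt.
have St : (I `&` c @^-1` chart_dom k) (line a b t).
  by split=> //=; rewrite -cc't.
have [U [F [[oO Ot agr] C1F]]] := cC1 k kA _ St.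
exists (line a b @^-1` U), (F \o line a b); split; last exact: Ck1_comp_line.
split=> //; first by apply: open_comp => // s _; exact: line_continuous.
move=> s /= Os [Js ds]; have [Is cc's] := JI s Js.
by rewrite agr//= ?cc's//; split=> //=; rewrite -cc's.
Qed.

Lemma near_within_interior (A : set R) (B : set X) c (t : R) :
  {within A, continuous c} -> (\forall s \near t, A s) -> A t ->
  open B -> B (c t) -> \forall s \near t, B (c s).
Proof.
move=> /subspace_continuousP cc nA At oB Bt.
have nB : nbhs (c t) B by exact: open_nbhs_nbhs.
have /= H : \forall s \near t, A s -> B (c s) by exact: cc t At B nB.
by apply: filterS2 H nA => s; apply.
Qed.

(** All charts at the point are included, since [speed] uses whichever one [chart_at] selects. *)
Definition derivable_in_charts c (t : R) :=
  forall k, atlas M k -> chart_dom k (c t) -> derivable (chart_map k \o c) t 1.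

Lemma C1_curve_derivable (u v : R) c (t : R) :
  (forall B, open B -> B (c t) -> \forall s \near t, B (c s)) ->
  C1_curve M `[u, v] c -> t \in `]u, v[ -> derivable_in_charts c t.
Proof.
move=> cc C1 tuv k kA dt.
have St : (`[u, v]%classic `&` c @^-1` chart_dom k) t.
  by split=> //=; exact: subset_itv_oo_cc.
have [U [F [[oO Ot agr] [dF _]]]] := C1 k kA _ St.
apply: (@near_eq_derivable _ _ _ F); last exact/diff_derivable/dF.
have nd := cc _ (@chart_dom_open _ _ k) dt.
have nuv := near_in_itvoo tuv.
have nO : \forall s \near t, U s by exact: open_nbhs_nbhs.
near=> s; apply: agr; first by near: s.
split => /=; last by near: s.
by apply: subset_itv_oo_cc; near: s.
Unshelve. all: by end_near. Qed.

Lemma partition_interior (n : nat) (t : nat -> R) (s : R) :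
  (forall i, (i < n)%N -> t i < t i.+1) -> t 0%N <= s <= t n ->
  (forall i, (i <= n)%N -> s <> t i) ->
  exists2 i, (i < n)%N & s \in `]t i, t i.+1[.
Proof.
elim: n => [_ /andP[s0 s1] /(_ 0%N isT) []|n IH tlt /andP[s0 s1] sn].
  by apply/eqP; rewrite eq_le s0 s1.
have [sltn|sgen] := leP s (t n).
- have [|||i iltn si] := IH.
  + by move=> i iltn; apply: tlt; exact: ltnW.
  + by rewrite s0.
  + by move=> i ilen; apply: sn; exact: leqW.
  by exists i => //; exact: ltnW.
- exists n => //; rewrite in_itv/= sgen/= lt_neqAle s1 andbT.
  exact/eqP/sn.
Qed.

Lemma piecewise_C1_derivable c : piecewise_C1_curve M c ->
  exists2 N : set R, finite_set N &
    (forall t, t \in `[0, 1] -> ~ N t ->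
       (t \in `]0, 1[) /\ derivable_in_charts c t).
Proof.
move=> [cc [n [t [t0 tn C1]]]].
exists (t @` `I_n.+1); first exact/finite_image/finite_II.
move=> s s01 sN.
have sneq i : (i <= n)%N -> s <> t i by move=> ilen st; apply: sN; exists i.
have s01o : s \in `]0, 1[.
  move: s01; rewrite !in_itv /= !lt_neqAle => /andP[-> ->]; rewrite !andbT.
  by rewrite eq_sym; apply/andP; split; apply/eqP;
    [rewrite -t0; exact: sneq|rewrite -tn; exact: sneq].
split=> //.
have [|||i iltn si] := @partition_interior n t s.
- by move=> i /C1 [].
- by rewrite t0 tn; move: s01; rewrite in_itv.
- exact: sneq.
have [_ C1i] := C1 i iltn.
apply: C1_curve_derivable si => // B oB Bs.
apply: near_within_interior cc _ _ oB Bs.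
- have := near_in_itvoo s01o; apply: filterS => r; exact: subset_itv_oo_cc.
- exact: subset_itv_oo_cc.
Qed.

Variable g : riemannian_metric M.

Lemma speed_ge0 c t : 0 <= speed g c t.
Proof. exact: sqrtr_ge0. Qed.

(** Both speeds are computed at the same point of [X], hence in the same selected chart; only the
    chain rule in that chart remains. *)
Lemma speed_line c c' a b (t : R) :
  (\forall s \near t, c' s = c (line a b s)) ->
  derivable_in_charts c (line a b t) ->
  speed g c' t = `|a| * speed g c (line a b t).
Proof.
move=> cc' dc; rewrite /speed (nbhs_singleton cc').
set k := chart_at _ _.
have dk : differentiable (chart_map k \o c) (line a b t).
  by apply/derivable1_diffP/dc; [exact: chart_at_atlas|exact: chart_at_dom].
have -> : (chart_map k \o c')^`()%classic t =
    a *: (chart_map k \o c)^`()%classic (line a b t).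
  rewrite !derive1E (@near_eq_derive _ _ _ _ ((chart_map k \o c) \o line a b)).
    rewrite derive_comp_line// scale1r !deriveE// -[X in 'd _ _ X]mulr1.
    exact: linearZ.
  by apply: filterS cc' => s /= ->.
set v := derive1 _ _; set G := rm_coef _ _ _.
have -> : (a *: v) *m G *m (a *: v)^T = (a ^+ 2) *: (v *m G *m v^T).
  by rewrite -scalemxAl -scalemxAl [(a *: v)^T]linearZ /= -scalemxAr scalerA.
by rewrite mxE sqrtrM ?sqr_ge0// sqrtr_sqr.
Qed.

End curves.

(** * The infimum of lengths *)

Ltac blra := repeat match goal with
  H : is_true (_ && _) |- _ => case/andP: H => ? ? end;
  try (apply/andP; split); lra.

Section infimum_of_lengths.
Context {R : realType} {X : topologicalType} {M : smooth_surface (R := R) X}.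
Variable g : riemannian_metric M.
Implicit Types (c : R -> X) (x y z : X) (a b : R).
Local Notation rline := (@line R R).
Local Notation mu := (@lebesgue_measure R).

Definition joins c x y := [/\ piecewise_C1_curve M c, c 0 = x & c 1 = y].

(** The infimum before [fine] is applied. It keeps the value [+oo] for points that no curve joins,
    so the triangle inequality holds without exception. *)
Definition length_inf x y : \bar R :=
  ereal_inf [set curve_length g c | c in [set c | joins c x y]].

Lemma curve_length_ge0 c : (0 <= curve_length g c)%E.
Proof. by apply: integral_ge0 => t _; rewrite lee_fin speed_ge0. Qed.

Lemma length_inf_ge0 x y : (0 <= length_inf x y)%E.
Proof. by apply: le_ereal_inf_tmp => _ [c _ <-]; exact: curve_length_ge0. Qed.

Lemma length_inf_le c x y : joins c x y ->
  (length_inf x y <= curve_length g c)%E.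
Proof. by move=> cxy; apply: ereal_inf_lbound; exists c. Qed.

Lemma line_within_continuous a b (I J : set R) c c' :
  (forall t, J t -> I (rline a b t) /\ c' t = c (rline a b t)) ->
  {within I, continuous c} -> {within J, continuous c'}.
Proof.
move=> JI /subspace_continuousP cc; apply/subspace_continuousP => t Jt.
have [It cc't] := JI t Jt; move=> B /= nB.
have nB0 : nbhs (c (rline a b t)) B by rewrite -cc't.
have nB' : \forall s \near rline a b t, I s -> B (c s) by exact: cc _ It B nB0.
have nB2 : \forall s \near t, I (rline a b s) -> B (c (rline a b s)).
  exact: @line_continuous R R a b t _ nB'.
have H3 : \forall s \near t, J s -> B (c' s).
  by apply: filterS nB2 => s /= H Js; have [Is ->] := JI s Js; exact: H.
exact: H3.
Qed.

(** Covers the reversal of a curve and both halves of a concatenation. The set [N] takes the times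
    at which [c'] follows [c] only on one side. *)
Lemma integral_speed_line_le a b c c' (D N : set R) :
  a != 0 -> finite_set N -> piecewise_C1_curve M c ->
  (forall t, D t -> ~ N t -> rline a b t \in `[0, 1] /\
     \forall s \near t, c' s = c (rline a b s)) ->
  (\int[mu]_(t in D) (speed g c' t)%:E <= curve_length g c)%E.
Proof.
move=> a0 finN pc H.
have [N1 finN1 HN1] := piecewise_C1_derivable pc.
(* Break points of [c], carried back to the parameter of [c'], are discarded as well. *)
pose N2 := N `|` [set a^-1 * (s - b) | s in N1].
apply: le_trans (@integral_le_finite_setD _ _ _ N2 _ _) _.
- by rewrite finite_setU; split=> //; exact: finite_image.
- by move=> t; rewrite lee_fin speed_ge0.
apply: (@le_integral_affine _ a b) => // [t|t|t [Dt]].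
- by rewrite lee_fin speed_ge0.
- by rewrite lee_fin speed_ge0.
move=> /not_orP[Nt N1t]; have [l01 cc'] := H t Dt Nt.
have lE : a * t + b = rline a b t by rewrite /line -[t *: a]/(t * a) mulrC.
rewrite lE; split=> //; rewrite -EFinM lee_fin (speed_line g cc')//.
have [|//] := HN1 _ l01; move=> Nl; apply: N1t; exists (rline a b t) => //.
by rewrite -lE; field.
Qed.

Lemma joins_cst x : joins (cst x) x x.
Proof.
split=> //; split; first by apply: continuous_subspaceT; exact: cst_continuous.
exists 1%N, (fun i => i%:R); split=> // i _; split; first by rewrite ltr_nat.
move=> k kA s [_ dx]; exists setT, (cst (chart_map k x)); split.
  by split=> //; exact: openT.
split=> [p _|v p _]; first exact: differentiable_cst.
have -> : (fun q => 'D_v (cst (chart_map k x)) q) = cst 0 :> (R -> 'rV[R]_2).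
  by apply/funext => q; rewrite derive_cst.
exact: cst_continuous.
Qed.

Lemma length_inf_refl x : length_inf x x = 0%E.
Proof.
apply/eqP; rewrite eq_le length_inf_ge0 andbT.
apply: le_trans (length_inf_le (joins_cst x)) _.
rewrite /curve_length integral0_eq// => t _; rewrite /speed.
have -> : derive1 (chart_map (chart_at M (cst x t)) \o cst x) t = 0.
  rewrite derive1E; set k := chart_at _ _.
  by rewrite (_ : _ \o _ = cst (chart_map k x))// derive_cst.
by rewrite mul0mx mul0mx mxE sqrtr0.
Qed.

Lemma joins_rev c x y : joins c x y -> joins (fun t => c (rline (-1) 1 t)) y x.
Proof.
have lE t : rline (-1) 1 t = 1 - t :> R by rewrite /line -[t *: _]/(t * _) mulrN1 addrC.
move=> [[cc [n [t [t0 tn C1]]]] c0 c1]; split; rewrite ?lE ?subr0 ?subrr//.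
split; first (apply: (@line_within_continuous (-1) 1 _ _ _ _ _ cc) => s;
  rewrite lE/= !in_itv/= => s01).
  by split; rewrite ?lE//; blra.
exists n, (fun i => 1 - t (n - i)%N); split=> [||i iltn].
- by rewrite subn0 tn subrr.
- by rewrite subnn t0 subr0.
have nilt : (n - i.+1 < n)%N by rewrite subnSK// leq_subr.
have [] := C1 _ nilt; rewrite subnSK// => tlt C1i; split; first blra.
apply: (C1_curve_line (a := -1) (b := 1) _ C1i) => s /=.
rewrite lE !in_itv/= => s01; split=> //; blra.
Qed.

Lemma length_inf_sym_le x y : (length_inf y x <= length_inf x y)%E.
Proof.
apply: le_ereal_inf_tmp => _ [c cxy <-].
apply: le_trans (length_inf_le (joins_rev cxy)) _.
have [pc _ _] := cxy.
apply: (@integral_speed_line_le (-1) 1 _ _ _ set0) => //.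
move=> t /= t01 _; split; last by near=> s.
rewrite /line -[t *: _]/(t * _) mulrN1 in_itv/=; move: t01; rewrite in_itv/=; blra.
Unshelve. all: by end_near. Qed.

Lemma length_inf_sym x y : length_inf x y = length_inf y x.
Proof. by apply/eqP; rewrite eq_le !length_inf_sym_le. Qed.

Definition concat c1 c2 (t : R) : X :=
  if t <= 2^-1 then c1 (rline 2 0 t) else c2 (rline 2 (-1) t).

Lemma line2E (b t : R) : rline 2 b t = t * 2 + b. Proof. by []. Qed.

Lemma joins_concat c1 c2 x y z : joins c1 x y -> joins c2 y z ->
  joins (concat c1 c2) x z.
Proof.
move=> [[cc1 [n1 [t1 [t10 t1n C1]]]] c10 c11] [[cc2 [n2 [t2 [t20 t2n C2]]]] c20 c21].
have E1 t : t <= 2^-1 -> concat c1 c2 t = c1 (rline 2 0 t) by rewrite /concat => ->.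
have E2 t : 2^-1 <= t -> concat c1 c2 t = c2 (rline 2 (-1) t).
  rewrite le_eqVlt => /orP[/eqP <-|t2h]; last by rewrite /concat leNgt t2h.
  rewrite E1// !line2E mulVf// addr0 c11 -c20; congr c2.
  by rewrite subrr.
split.
- split.
  + have -> : `[0, 1]%classic = `[0, 2^-1]%classic `|` `[2^-1, 1]%classic :> set R.
      apply/seteqP; split=> t /=; rewrite !in_itv/=; last by case; blra.
      by move=> t01; have [h|h] := leP t 2^-1; [left|right]; blra.
    apply: withinU_continuous; [exact: itv_closed|exact: itv_closed| |].
    * apply: (@line_within_continuous 2 0 _ _ _ _ _ cc1) => t; rewrite /= !in_itv/= => h; split.
        by rewrite line2E; blra.
      by rewrite E1//; blra.
    * apply: (@line_within_continuous 2 (-1) _ _ _ _ _ cc2) => t; rewrite /= !in_itv/= => h; split.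
        by rewrite line2E; blra.
      by rewrite E2//; blra.
  (* Both partitions are halved and the second is shifted to start at [2^-1]. At the index [n1] the
     two formulas agree, because [t1 n1 = 1] and [t2 0 = 0]. *)
  + exists (n1 + n2)%N, (fun i => if (i <= n1)%N then t1 i / 2
                                  else 2^-1 + t2 (i - n1)%N / 2).
    split=> [||i iltn].
    * by rewrite leq0n t10 mul0r.
    (* The last index falls in the first branch only if [n2 = 0], which would give
       [0 = t2 0 = t2 n2 = 1]. *)
    * case: ifPn => [|_].
        rewrite -[leqRHS]addn0 leq_add2l leqn0 => /eqP n20.
        by move: t2n; rewrite n20 t20 => /eqP; rewrite eq_sym oner_eq0.
      by rewrite addKn t2n; field.
    have [iltn1|n1lei] := ltnP i n1.
      rewrite (ltnW iltn1); have [tlt C1i] := C1 _ iltn1; split; first blra.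
      have [ub _] : t1 i.+1 <= 1 /\ True.
        split=> //.
        have : forall m, (i.+1 + m <= n1)%N -> t1 i.+1 <= t1 (i.+1 + m)%N.
          elim=> [|m IH]; first by rewrite addn0.
          rewrite addnS => h; apply: le_trans (IH (ltnW h)) _.
          by have [/ltW] := C1 _ h.
        by move=> /(_ (n1 - i.+1)%N); rewrite subnKC// leqnn t1n; apply.
      apply: (C1_curve_line (a := 2) (b := 0) _ C1i) => t; rewrite /= !in_itv/= => h; split.
        by rewrite line2E; blra.
      by rewrite E1//; blra.
    have jlt : (i - n1 < n2)%N by rewrite ltn_subLR.
    have [tlt C2j] := C2 _ jlt.
    have -> : (if (i <= n1)%N then t1 i / 2 else 2^-1 + t2 (i - n1)%N / 2)
       = 2^-1 + t2 (i - n1)%N / 2.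
      case: ifPn => // ilen1.
      have -> : i = n1 by apply/eqP; rewrite eqn_leq ilen1.
      by rewrite subnn t20 t1n; blra.
    rewrite subSn//; split; first blra.
    have lb : 0 <= t2 (i - n1)%N.
      have : forall m, (m <= n2)%N -> 0 <= t2 m.
        elim=> [|m IH mlt]; first by rewrite t20.
        by apply: le_trans (IH (ltnW mlt)) _; have [/ltW] := C2 _ mlt.
      by apply; exact: ltnW.
    apply: (C1_curve_line (a := 2) (b := -1) _ C2j) => t; rewrite /= !in_itv/= => h; split.
      by rewrite line2E; blra.
    by rewrite E2//; blra.
- by rewrite E1 ?invr_ge0// line2E mul0r addr0.
- by rewrite E2 ?invf_le1 ?ler1n// line2E -c21; congr c2; blra.
Qed.

Lemma curve_length_concat_le c1 c2 x y z : joins c1 x y -> joins c2 y z ->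
  (curve_length g (concat c1 c2) <= curve_length g c1 + curve_length g c2)%E.
Proof.
move=> [pc1 _ _] [pc2 _ _].
have f0 t : (0 <= (speed g (concat c1 c2) t)%:E)%E by rewrite lee_fin speed_ge0.
(* With the cut open at [2^-1], every point of the first half has a neighbourhood on which the
   concatenation follows [c1]. On the second half [2^-1] itself has to be excepted. *)
pose A : set R := [set` `]-oo, 2^-1[].
have mA : measurable (A : set (measurableTypeR R)) by exact: measurable_itv.
apply: (le_trans (le_integral_split `[0, 1]%classic mA f0)).
apply: leeD.
- apply: (@integral_speed_line_le 2 0 _ _ _ set0) => // t [].
  rewrite /A /= !in_itv/= => t01 t2 _; rewrite line2E; split; first blra.
  near=> s; rewrite /concat ltW//; near: s; exact: lt_nbhsl.
- apply: (@integral_speed_line_le 2 (-1) _ _ _ [set 2^-1]) => // t [].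
  rewrite /A /= !in_itv/= => t01 /negP; rewrite -leNgt => t2 /eqP tn2.
  rewrite line2E; split; first blra.
  near=> s; rewrite /concat leNgt ifN//= negbK; near: s.
  by apply: lt_nbhsr; rewrite lt_neqAle eq_sym tn2.
Unshelve. all: by end_near. Qed.

Lemma length_inf_triangle x y z :
  (length_inf x z <= length_inf x y + length_inf y z)%E.
Proof.
have [/eqP ->|xy] := boolP (length_inf x y == +oo%E).
  by rewrite addye ?leey// gt_eqF// (lt_le_trans _ (length_inf_ge0 _ _)).
have [/eqP ->|yz] := boolP (length_inf y z == +oo%E).
  by rewrite addey ?leey// gt_eqF// (lt_le_trans _ (length_inf_ge0 _ _)).
have fxy : length_inf x y \is a fin_num by rewrite ge0_fin_numE ?length_inf_ge0 ?ltey.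
have fyz : length_inf y z \is a fin_num by rewrite ge0_fin_numE ?length_inf_ge0 ?ltey.
apply/lee_addgt0Pr => e e0.
have e20 : 0 < e / 2 by rewrite divr_gt0.
have [_ [c1 c1xy <-] l1] := lb_ereal_inf_adherent e20 fxy.
have [_ [c2 c2yz <-] l2] := lb_ereal_inf_adherent e20 fyz.
apply: le_trans (length_inf_le (joins_concat c1xy c2yz)) _.
apply: le_trans (curve_length_concat_le c1xy c2yz) _.
apply: le_trans (leeD (ltW l1) (ltW l2)) _.
by rewrite addeACA -EFinD -splitr.
Qed.

End infimum_of_lengths.

(** * Rescaling a Riemannian metric *)

Section smooth_scaling.
Context {R : realType} {V W : normedModType R}.
Implicit Types (F G : V -> W) (O : set V).

Lemma near_eq_differentiable F G (x : V) :
  (\forall y \near x, F y = G y) -> differentiable F x -> differentiable G x.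
Proof.
move=> FG /diff_locallyP[cF eF]; have FGx := nbhs_singleton FG.
have eG : G \o shift x = cst (G x) + 'd F x +o_ (0 : V) id.
  apply/eqaddoP => e e0.
  have /eqaddoP/(_ e e0) HF := eF.
  have FG0 : \forall h \near (0 : V), F (h + x) = G (h + x).
    have cs : {for (0 : V), continuous (shift x)}.
      by apply: cvgD; [exact: cvg_id|exact: cvg_cst].
    have nFG : nbhs (shift x (0 : V)) [set y | F y = G y] by rewrite /= add0r.
    exact: cs _ nFG.
  apply: filterS2 HF FG0 => h /= HF FGh.
  move: HF; by rewrite -FGx !fctE /= FGh.
apply/diff_locallyP.
by rewrite (diff_unique cF eG).
Qed.

(** The relation between [F] and [G] is required only on [O], the form in which it passes to the
    derivatives during the induction. *)
Lemma Ck_scale n (k : R) F G O : open O -> (forall p, O p -> G p = k *: F p) ->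
  Ck n O F -> Ck n O G.
Proof.
move=> oO; elim: n F G => [|n IH] F G FG.
  move=> cF p Op; have nO : \forall q \near p, O q by exact: open_nbhs_nbhs.
  have nFG : \forall q \near p, k *: F q = G q.
    by apply: filterS nO => q Oq; rewrite FG.
  rewrite /prop_for /continuous_at FG//.
  apply: cvg_trans (near_eq_cvg nFG) _.
  by apply: cvgZl_tmp; exact: cF.
move=> [dF DF].
have nFG p : O p -> \forall q \near p, (k *: F) q = G q.
  move=> Op; have nO : \forall q \near p, O q by exact: open_nbhs_nbhs.
  by apply: filterS nO => q Oq; rewrite FG.
split=> [p Op|v].
  by apply: near_eq_differentiable (nFG p Op) _; apply/differentiableZ/dF.
apply: IH (DF v) => p Op.
rewrite -(near_eq_derive v (nFG p Op)) deriveZ//.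
exact/diff_derivable/dF.
Qed.

Lemma smooth_scale (k : R) F O : open O -> smooth O F ->
  smooth O (fun p => k *: F p).
Proof. by move=> oO sF n; exact: (@Ck_scale n k F _ O oO _ (sF n)). Qed.

End smooth_scaling.

Section metric_scaling.
Context {R : realType} {X : topologicalType} {M : smooth_surface (R := R) X}.
Implicit Types (g : riemannian_metric M) (x y : X) (k : R).
Local Notation mu := (@lebesgue_measure R).

Lemma riemannian_scaling g k : 0 < k -> exists g' : riemannian_metric M,
  forall c t, speed g' c t = k * speed g c t.
Proof.
move=> k0; have k20 : 0 < k ^+ 2 by rewrite exprn_gt0.
pose G a p := k ^+ 2 *: rm_coef g a p.
have sm a : atlas M a -> smooth_on (chart_img a) (G a).
  move=> /(@rm_smooth _ _ _ g) sa p /sa [U [F [[oU Up FU] sF]]].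
  exists U, (fun p => k ^+ 2 *: F p); split; last exact: smooth_scale.
  by split=> // q Uq aq; rewrite FU.
have sy a p : atlas M a -> chart_img a p -> (G a p)^T = G a p.
  by move=> aA pa; rewrite linearZ/= (rm_sym g aA pa).
have gE a p (v : 'rV[R]_2) :
    v *m G a p *m v^T = k ^+ 2 *: (v *m rm_coef g a p *m v^T).
  by rewrite -scalemxAr -scalemxAl.
have pd a p (v : 'rV[R]_2) : atlas M a -> chart_img a p -> v != 0 ->
    0 < (v *m G a p *m v^T) ord0 ord0.
  move=> aA pa v0; rewrite gE mxE; apply: mulr_gt0 => //.
  exact: (@rm_posdef _ _ _ g _ _ _ aA pa v0).
have ch a b x U F : atlas M a -> atlas M b -> chart_dom a x -> chart_dom b x ->
    local_extension (overlap a b) (transition a b) (chart_map a x) U F ->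
    smooth U F -> G a (chart_map a x) =
      'J F (chart_map a x) *m G b (chart_map b x) *m ('J F (chart_map a x))^T.
  move=> aA bA ax bx eF sF; rewrite /G (rm_change g aA bA ax bx eF sF).
  by rewrite -scalemxAr -scalemxAl.
exists (RiemannianMetric sm sy pd ch) => c t.
by rewrite /speed /= gE mxE sqrtrM ?sqr_ge0// sqrtr_sqr gtr0_norm.
Qed.

(** One inequality is enough: the other one is the same statement with [g] and [g'] exchanged and
    [k] inverted. Homogeneity of the integral is again applied to simple functions. *)
Lemma length_inf_scaling_le g g' k x y : 0 < k ->
  (forall c t, speed g' c t = k * speed g c t) ->
  (length_inf g' x y <= k%:E * length_inf g x y)%E.
Proof.
move=> k0 sE; rewrite -lee_pdivrMl//.
apply: le_ereal_inf_tmp => _ [c cxy <-].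
rewrite lee_pdivrMl//; apply: le_trans (length_inf_le g' cxy) _.
apply: integral_le_simple => [t|h mh h0 hf hD]; first by rewrite lee_fin speed_ge0.
have ik0 : 0 < k^-1 by rewrite invr_gt0.
rewrite -lee_pdivrMl// -ge0_integralZl_EFin//; last 3 first.
- by move=> t _; rewrite lee_fin.
- exact/measurable_EFinP.
- exact: ltW.
apply: le_integral_nonmeasurable => [t|t|t _].
- by rewrite -EFinM lee_fin mulr_ge0// ltW.
- by rewrite lee_fin speed_ge0.
have [Dt|/hD ->] := pselect (`[0, 1]%classic t); last by right; rewrite mule0.
by left; split=> //; rewrite lee_pdivrMl// -EFinM -sE; exact: hf.
Qed.

Lemma intrinsic_metric_scaling g k : 0 < k -> exists g' : riemannian_metric M,
  forall x y, intrinsic_metric g' x y = k * intrinsic_metric g x y.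
Proof.
move=> k0; have [g' sE] := riemannian_scaling g k0; exists g' => x y.
have le1 := length_inf_scaling_le x y k0 sE.
have sE' c t : speed g c t = k^-1 * speed g' c t.
  by rewrite sE mulrA mulVf ?mul1r// gt_eqF.
have ik0 : 0 < k^-1 by rewrite invr_gt0.
have le2 := length_inf_scaling_le x y ik0 sE'.
rewrite lee_pdivlMl// in le2.
have E : length_inf g' x y = (k%:E * length_inf g x y)%E.
  by apply/eqP; rewrite eq_le le1 le2.
rewrite /intrinsic_metric -/(length_inf g' x y) -/(length_inf g x y) E.
(* If no curve joins the points, both intrinsic distances are [fine +oo = 0], so the scaling holds
   there too. *)
have := length_inf_ge0 g x y; case: (length_inf g x y) => [r| |]//= _.
by rewrite gt0_muley ?lte_fin// mulr0.
Qed.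

End metric_scaling.

(** * Short curves in charts *)

Section short_curves.
Context {R : realType} {X : topologicalType} {M : smooth_surface (R := R) X}.
Variable g : riemannian_metric M.
Local Notation mu := (@lebesgue_measure R).
Implicit Types (v p q : 'rV[R]_2).

Lemma mx_entry_le_norm m n (A : 'M[R]_(m.+1, n.+1)) i j : `|A i j| <= `|A|.
Proof.
rewrite [`|A|]mx_normrE.
exact: (@le_bigmax_cond _ _ _ _ (i, j) xpredT (fun ij => `|A ij.1 ij.2|)).
Qed.

Lemma quadratic_form_le v (G : 'M[R]_2) :
  (v *m G *m v^T) ord0 ord0 <= 4 * `|v| ^+ 2 * `|G|.
Proof.
have vi i := mx_entry_le_norm v ord0 i.
have Gi i j := mx_entry_le_norm G i j.
have H i j : v ord0 i * G i j * v ord0 j <= `|v| ^+ 2 * `|G|.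
  apply: le_trans (ler_norm _) _; rewrite !normrM.
  by rewrite expr2 -mulrA [`|v| * `|v|]mulrC -!mulrA ler_pM ?mulr_ge0//
    [leRHS]mulrC ler_pM.
rewrite mxE !big_ord_recl big_ord0 !mxE !big_ord_recl !big_ord0 !addr0.
rewrite -[leRHS]mulrA.
have := H ord0 ord0; have := H ord0 (lift ord0 ord0).
have := H (lift ord0 ord0) ord0; have := H (lift ord0 ord0) (lift ord0 ord0).
by lra.
Qed.

Section straight_curve.
Variables (k : chart (R := R) X) (p q : 'rV[R]_2).
Hypothesis kA : atlas M k.
Let v : 'rV[R]_2 := q - p.
Let c (t : R) := chart_inv k (line v p t).
Hypothesis seg : forall t, t \in `[0, 1] -> chart_img k (line v p t).

Let chart_c t : t \in `[0, 1] ->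
  chart_dom k (c t) /\ chart_map k (c t) = line v p t.
Proof.
move=> /seg kt; have [_ fi _ ci _] := chart_homeo k.
by split; [exact: fi|apply: ci; rewrite inE].
Qed.

Let c_continuous : {within `[0, 1], continuous c}.
Proof.
have [_ _ _ _ [_ /subspace_continuousP ic]] := chart_homeo k.
apply/subspace_continuousP => t t01 B /= nB.
have H1 : \forall z \near line v p t, chart_img k z -> B (chart_inv k z).
  exact: ic (seg t01) B nB.
have H2 : \forall s \near t,
    chart_img k (line v p s) -> B (chart_inv k (line v p s)).
  exact: line_continuous _ H1.
have H3 : \forall s \near t, `[0, 1]%classic s -> B (c s).
  by apply: filterS H2 => s H /seg; exact: H.
exact: H3.
Qed.

(** Seen in another chart [b], the segment is the image of a line under the transition map. Since
    the overlap need not be open at the boundary, a smooth local extension [F] stands in for that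
    map. *)
Let chart_change (b : chart X) t : atlas M b -> t \in `[0, 1] ->
  chart_dom b (c t) -> exists U F,
  [/\ local_extension (overlap k b) (transition k b) (line v p t) U F, smooth U F
    & forall s, s \in `[0, 1] -> U (line v p s) -> chart_dom b (c s) ->
       F (line v p s) = chart_map b (c s)].
Proof.
move=> bA t01 bt.
have ov s : s \in `[0, 1] -> chart_dom b (c s) -> overlap k b (line v p s).
  by move=> /chart_c[ks kcs] bs; exists (c s).
have [U [F [lF sF]]] := atlas_compatible kA bA (ov t t01 bt).
exists U, F; split=> // s s01 Us bs.
by have [_ _ ->//] := lF; exact: ov.
Qed.

Let straight_curve_C1 : C1_curve M `[0, 1] c.
Proof.
move=> b bA t [t01 bt]; have [U [F [[oU Ut _] sF FE]]] := chart_change bA t01 bt.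
exists (line v p @^-1` U), (F \o line v p); split; last first.
  exact: Ck1_comp_line (sF 1%N).
split=> //; first by apply: open_comp => // s _; exact: line_continuous.
by move=> s Us [s01 bs]; exact: FE.
Qed.

(** The speed lives in the selected chart [b]; the transformation rule [rm_change] brings the
    quadratic form back to [k], where the velocity is the constant [v]. *)
Let straight_curve_speed t : t \in `]0, 1[ ->
  speed g c t = Num.sqrt ((v *m rm_coef g k (line v p t) *m v^T) ord0 ord0).
Proof.
move=> t01o; have t01 := subset_itv_oo_cc t01o; rewrite /speed.
set b := chart_at M (c t).
have bA : atlas M b := chart_at_atlas _ _.
have bt : chart_dom b (c t) := chart_at_dom _ _.
have [U [F [lF sF FE]]] := chart_change bA t01 bt.
have [oU Ut _] := lF.
have dF : differentiable F (line v p t) by have [+ _] := sF 1%N; apply.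
have n01 := near_in_itvoo t01o.
have nb : \forall s \near t, chart_dom b (c s).
  apply: near_within_interior c_continuous _ _ (@chart_dom_open _ _ b) bt => //.
  by apply: filterS n01; exact: subset_itv_oo_cc.
have nU : \forall s \near t, U (line v p s).
  by apply: line_continuous; exact: open_nbhs_nbhs.
have nE : \forall s \near t, (chart_map b \o c) s = (F \o line v p) s.
  near=> s; rewrite /= -FE//; [|by near: s..].
  by apply: subset_itv_oo_cc; near: s.
rewrite derive1E (near_eq_derive _ nE) derive_comp_line// scale1r.
rewrite (deriveEjacobian _ dF).
have [kt kct] := chart_c t01.
have := @rm_change _ _ _ g k b (c t) U F kA bA kt bt; rewrite kct => ->//.
by rewrite trmx_mul !mulmxA.
Unshelve. all: by end_near. Qed.

Lemma straight_curve_joins : joins (M := M) c (chart_inv k p) (chart_inv k q).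
Proof.
split.
- split; first exact: c_continuous.
  exists 1%N, (fun i => i%:R); split=> // -[|//] _; split; first by rewrite ltr_nat.
  exact: straight_curve_C1.
- by rewrite /c /line scale0r add0r.
- by rewrite /c /line scale1r subrK.
Qed.

Lemma straight_curve_length (C : R) :
  (forall t, t \in `[0, 1] -> `|rm_coef g k (line v p t)| <= C) ->
  (curve_length g c <= (2 * `|v| * Num.sqrt C)%:E)%E.
Proof.
move=> GC.
have L0 : 0 <= 2 * `|v| * Num.sqrt C by rewrite !mulr_ge0// sqrtr_ge0.
apply: le_trans (@integral_le_finite_setD _ _ _ [set 0; 1] _ _) _.
- by [].
- by move=> t; rewrite lee_fin speed_ge0.
apply: (@le_trans _ _ (\int[mu]_(t in `[0%R, 1%R]) (2 * `|v| * Num.sqrt C)%:E)%E).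
  apply: le_integral_nonmeasurable => [t|t|t [t01 Nt]].
  - by rewrite lee_fin speed_ge0.
  - by rewrite lee_fin.
  left; split=> //; rewrite lee_fin straight_curve_speed; last first.
    move: t01; rewrite /= !in_itv/= !lt_neqAle => /andP[-> ->]; rewrite !andbT.
    by apply/andP; split; apply/eqP => h; apply: Nt; [left|right].
  have -> : 2 * `|v| * Num.sqrt C = Num.sqrt (4 * `|v| ^+ 2 * C).
    rewrite sqrtrM ?mulr_ge0// sqrtrM// sqrtr_sqr normr_id.
    by rewrite (_ : 4 = 2 ^+ 2) ?sqrtr_sqr ?ger0_norm//; ring.
  rewrite ler_wsqrtr//; apply: le_trans (quadratic_form_le _ _) _.
  by rewrite ler_wpM2l ?mulr_ge0//; exact: GC.
rewrite integral_cst//= lebesgue_measure_itv/= lte_fin ltr01.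
by rewrite sube0 mule1.
Qed.

End straight_curve.

(** A nearby point is joined to [x] by the segment in a chart at [x]. Balls and the half-plane are
    convex, so the segment stays in the chart image, and its length is at most a constant times the
    coordinate distance. *)
Lemma length_inf_nbhs (x : X) (e : R) : 0 < e ->
  nbhs x [set y | (length_inf g x y < e%:E)%E].
Proof.
move=> e0; pose k := chart_at M x; pose p := chart_map k x.
have kA : atlas M k := chart_at_atlas _ _.
have kx : chart_dom k x := chart_at_dom _ _.
have [fk fi ck ci [/subspace_continuousP mc _]] := chart_homeo k.
have [U oU imgE] := chart_img_open k.
have pimg : chart_img k p by exact: fk.
have Up : U p by move: pimg; rewrite imgE => -[].
have [V [G [[oV Vp GE] sG]]] := @rm_smooth _ _ _ g _ kA _ pimg.
have cG : {for p, continuous G} by exact: (sG 0%N).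
pose C := `|G p| + 1.
have sC0 : 0 <= Num.sqrt C by exact: sqrtr_ge0.
have nG : \forall q \near p, `|G q| <= C.
  have : \forall q \near p, `|G p - G q| < 1 by have /cvgr_dist_lt/(_ _ ltr01) := cG.
  apply: filterS => q dq; rewrite /C.
  by have := ler_distD (G p) 0 (G q); rewrite !sub0r !normrN; lra.
have nU : \forall q \near p, U q by exact: open_nbhs_nbhs.
have nV : \forall q \near p, V q by exact: open_nbhs_nbhs.
have nall : nbhs p (U `&` (V `&` [set q | `|G q| <= C])).
  exact: filterI nU (filterI nV nG).
have [r /= r0 Br] := (nbhs_ballP _ _).1 nall.
have d0 : 0 < 2 * Num.sqrt C + 1 by rewrite ltr_wpDl ?mulr_ge0.
pose s := Num.min r (e / (2 * Num.sqrt C + 1)).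
have s0 : 0 < s by rewrite lt_min r0 divr_gt0.
have ns : \forall q \near p, `|p - q| < s by have := nbhsx_ballx p s s0; rewrite -ball_normE.
have nx1 : \forall y \near x, chart_dom k y -> `|p - chart_map k y| < s.
  exact: mc kx _ ns.
have nx2 : \forall y \near x, chart_dom k y.
  by apply: open_nbhs_nbhs; split => //; exact: chart_dom_open.
apply: filterS2 nx1 nx2 => y /[swap] ky /(_ ky); rewrite /=.
set q := chart_map k y => pq.
have qimg : chart_img k q by exact: fk.
have inball t : t \in `[0, 1] -> ball p r (line (q - p) p t).
  rewrite in_itv/= => /andP[t0 t1]; rewrite -ball_normE /ball_ /= /line.
  rewrite opprD addrCA subrr addr0 normrN normrZ ger0_norm//.
  apply: le_lt_trans (_ : `|p - q| < r).
    by rewrite distrC ler_piMl.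
  by apply: lt_le_trans pq _; rewrite ge_min lexx.
have seg t : t \in `[0, 1] -> chart_img k (line (q - p) p t).
  move=> t01; have [Ut _] := Br _ (inball t t01).
  rewrite imgE; split=> //.
  move: pimg qimg t01; rewrite imgE => -[_ +] [_ +].
  rewrite /half_plane /= in_itv/= /line !mxE => p0 q0 /andP[t0 t1].
  have -> : forall a b : R, t * (b - a) + a = (1 - t) * a + t * b by move=> a b; ring.
  by rewrite addr_ge0// mulr_ge0// subr_ge0.
have Gle t : t \in `[0, 1] -> `|rm_coef g k (line (q - p) p t)| <= C.
  move=> t01; have [_ [Vt Gt]] := Br _ (inball t t01).
  by rewrite -GE//; exact: seg.
have := straight_curve_joins kA seg; rewrite (ck x) ?inE// (ck y) ?inE// => cxy.
apply: le_lt_trans (length_inf_le g cxy) _.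
apply: le_lt_trans (straight_curve_length kA seg Gle) _.
rewrite lte_fin; have qp : `|q - p| < e / (2 * Num.sqrt C + 1).
  by rewrite distrC; apply: lt_le_trans pq _; rewrite ge_min lexx orbT.
move: qp; rewrite ltr_pdivlMr// mulrDr mulr1.
have := normr_ge0 (q - p).
by set a := `|_|; set b := Num.sqrt C; rewrite mulrAC -mulrA mulrCA; lra.
Qed.

End short_curves.

(** * Compact metrics *)

Section metric_basics.
Context {R : realType} {X : Type}.
Variables (d : X -> X -> R).
Hypothesis dm : is_metric d.

Lemma is_metric_refl x : d x x = 0.
Proof. by case: dm => d0 _ _; exact/d0. Qed.

Lemma is_metric_sym x y : d x y = d y x.
Proof. by case: dm. Qed.

Lemma is_metric_triangle x y z : d x z <= d x y + d y z.
Proof. by case: dm. Qed.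

Lemma is_metric_ge0 x y : 0 <= d x y.
Proof.
by have := is_metric_triangle x y x; rewrite is_metric_refl (is_metric_sym y x); lra.
Qed.

Lemma is_metric_eq0 x y : d x y = 0 -> x = y.
Proof. by case: dm => d0 _ _ /d0. Qed.

Lemma is_metric_gt0 x y : x <> y -> 0 < d x y.
Proof.
by move=> xy; rewrite lt_neqAle is_metric_ge0 andbT eq_sym; apply/eqP => /is_metric_eq0.
Qed.

Lemma is_metric_le0 x y : (forall e, 0 < e -> d x y < e) -> x = y.
Proof.
move=> h; apply/is_metric_eq0/eqP; rewrite eq_le is_metric_ge0 andbT.
by apply/ler_addgt0Pl => e /h; rewrite addr0 => /ltW.
Qed.

End metric_basics.

(** Used with [e] an intrinsic metric, which is not yet known to separate points: separation is
    inherited through a homeomorphism with a metric space. *)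
Lemma dcontinuous_eq0 (R : realType) (X Y : Type) (e : X -> X -> R)
    (d : Y -> Y -> R) (f : X -> Y) (x y : X) : is_metric d ->
  dcontinuous e d f -> e x y = 0 -> f x = f y.
Proof.
move=> dm cf exy; apply: (is_metric_le0 dm) => r r0.
have [s s0 sf] := cf x r r0; apply: (sf (f y)); exists y => //.
by rewrite /dball /= exy.
Qed.

Section compact_metric.
Context {R : realType} {X : topologicalType} (e : X -> X -> R).
Hypothesis em : is_metric e.
Hypothesis Xc : compact [set: X].
Hypothesis enbhs : forall x r, 0 < r -> nbhs x (dball e x r).

(** Along an ultrafilter every sequence converges, so limits are taken for all points, and for
    choices of points, without extracting subsequences. *)
Definition ultra_compact (Y : Type) (d : Y -> Y -> R) :=
  forall U : set_system nat, UltraFilter U -> forall u : nat -> Y,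
    exists w, forall r, 0 < r -> U [set k | d w (u k) < r].

Lemma compact_ultra_compact : ultra_compact e.
Proof.
move=> U UU u; have PU := ultra_proper.
have [//|w [_ cw]] := Xc (F := fmap u U) _; first exact: filterT.
exists w => r r0; have nB := enbhs w r0.
have [//|UC] := in_ultra_setVsetC [set k | e w (u k) < r] UU.
have FC : fmap u U (~` dball e w r) by [].
by have [z [/= zn zB]] := cw _ _ FC nB.
Qed.

Lemma metric_continuous x : continuous (e x).
Proof.
move=> y; apply/cvgrPdist_lt => r r0.
apply: filterS (enbhs y r0) => z /= yz.
have := is_metric_triangle em x y z; have := is_metric_triangle em x z y.
rewrite (is_metric_sym em z y); rewrite /dball /= in yz.
by rewrite ltr_norml => *; apply/andP; split; lra.
Qed.

Lemma metric_intermediate x w (r : R) : connected [set: X] -> 0 <= r <= e x w ->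
  exists z, e x z = r.
Proof.
move=> Xn rw.
have : connected (e x @` [set: X]).
  apply: connected_continuous_connected => //.
  exact/continuous_subspaceT/metric_continuous.
move=> /connected_intervalP/(_ 0 (e x w)) H.
have [||z _ <-] := H _ _ _ rw; [|by exists w|by exists z].
by exists x => //; exact: is_metric_refl.
Qed.

Lemma metric_bounded : exists B, forall x y, e x y <= B.
Proof.
have [[x0 _]|X0] := pselect ([set: X] !=set0); last first.
  by exists 0 => x; case: X0; exists x.
have : compact (e x0 @` [set: X]).
  by apply: continuous_compact => //; exact/continuous_subspaceT/metric_continuous.
move=> /compact_bounded[B [_ HB]]; exists ((B + 1) + (B + 1)) => x y.
have H z : e x0 z <= B + 1.
  apply: le_trans (ler_norm _) _; apply: (HB (B + 1)); last by exists z.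
  by rewrite ltrDl.
apply: le_trans (is_metric_triangle em x x0 y) _.
by rewrite (is_metric_sym em x x0) lerD.
Qed.

End compact_metric.

(** * The intrinsic metric as a continuous metric *)

Section intrinsic.
Context {R : realType} {X : topologicalType} {M : smooth_surface (R := R) X}.
Variable g : riemannian_metric M.

(* [intrinsic_metric] takes the junk value [0] on points that no curve joins, so
   separation of points also gives finiteness. *)
Hypothesis sep : forall x y, intrinsic_metric g x y = 0 -> x = y.

Lemma intrinsic_metricE x y : (intrinsic_metric g x y)%:E = length_inf g x y.
Proof.
rewrite /intrinsic_metric -/(length_inf g x y).
have [E|E] := eqVneq (length_inf g x y) +oo%E.
  have xy : x = y by apply: sep; rewrite /intrinsic_metric -/(length_inf g x y) E.
  by rewrite xy length_inf_refl.
by rewrite fineK// ge0_fin_numE ?length_inf_ge0// ltey.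
Qed.

Lemma intrinsic_is_metric : is_metric (intrinsic_metric g).
Proof.
split=> [x y|x y|x y z].
- split; first exact: sep.
  by move=> ->; apply: EFin_inj; rewrite intrinsic_metricE length_inf_refl.
- by apply: EFin_inj; rewrite !intrinsic_metricE length_inf_sym.
- by rewrite -lee_fin EFinD !intrinsic_metricE; exact: length_inf_triangle.
Qed.

Lemma intrinsic_metric_nbhs x r : 0 < r ->
  nbhs x (dball (intrinsic_metric g) x r).
Proof.
move=> r0; apply: filterS (length_inf_nbhs g x r0) => y /=.
by rewrite -intrinsic_metricE lte_fin.
Qed.

End intrinsic.

(** * Distortion functions *)

Section halfline.
Context {R : realType}.
Implicit Types (f g h eta theta : R -> R).

(** An order-theoretic form of the homeomorphisms of the half-line, together with the inverse:
    continuity is a consequence, and composites, sums and inverses are handled by monotonicity. *)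
Definition halfline_iso f g : Prop :=
  [/\ forall x, 0 <= x -> 0 <= f x, forall x, 0 <= x -> 0 <= g x,
      forall x, 0 <= x -> g (f x) = x, forall x, 0 <= x -> f (g x) = x
    & forall x y, 0 <= x -> x < y -> f x < f y].

Lemma halfline_iso_lt f g x y : halfline_iso f g -> 0 <= x -> 0 <= y ->
  (f x < f y) = (x < y).
Proof.
move=> [_ _ _ _ fl] x0 y0; have [xy|yx|->] := ltgtP x y.
- exact: fl.
- by apply/negbTE; rewrite -leNgt ltW// fl.
- by rewrite ltxx.
Qed.

Lemma halfline_iso_le f g x y : halfline_iso f g -> 0 <= x -> 0 <= y ->
  (f x <= f y) = (x <= y).
Proof. by move=> fg x0 y0; rewrite !leNgt (halfline_iso_lt fg). Qed.

Lemma halfline_iso0 f g : halfline_iso f g -> f 0 = 0.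
Proof.
move=> fg; have [f0 g0 _ gK _] := fg; apply/eqP; rewrite eq_le f0// andbT.
by rewrite -[leRHS]gK// (halfline_iso_le fg) ?g0.
Qed.

Lemma halfline_iso_sym f g : halfline_iso f g -> halfline_iso g f.
Proof.
move=> fg; have [f0 g0 fK gK fl] := fg; split=> // x y x0 xy.
have y0 : 0 <= y by lra.
by rewrite -(halfline_iso_lt fg) ?g0// !gK.
Qed.

Lemma halfline_iso_gt0 f g x : halfline_iso f g -> 0 < x -> 0 < f x.
Proof. by move=> fg x0; rewrite -(halfline_iso0 fg) (halfline_iso_lt fg)// ltW. Qed.

Lemma halfline_iso_small f g (e : R) : halfline_iso f g -> 0 < e ->
  exists2 r, 0 < r & forall t, 0 <= t -> t < r -> f t < e.
Proof.
move=> fg e0; exists (g e); first exact: halfline_iso_gt0 (halfline_iso_sym fg) e0.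
have [_ g0 _ gK _] := fg.
by move=> t t0 tg; rewrite -(gK e (ltW e0)) (halfline_iso_lt fg) ?g0// ltW.
Qed.

Lemma halfline_iso_continuous f g : halfline_iso f g ->
  {within [set t : R | 0 <= t], continuous f}.
Proof.
move=> fg; have [f0 g0 fK gK fl] := fg.
apply/subspace_continuousP => x x0; rewrite /= in x0.
apply/cvgrPdist_lt => e e0.
have fx0 := f0 x x0.
have hi0 : 0 <= f x + e by lra.
have xhi : x < g (f x + e) by rewrite -(halfline_iso_lt fg) ?g0// gK; lra.
have H : \forall t \near x, 0 <= t -> `|f x - f t| < e.
  (* Below [0] the point [g (f x - e)] is meaningless, but then the lower bound follows from
     [0 <= f t]. *)
  have [lo|lo] := ltP (f x - e) 0.
    near=> t; move=> t0.
    have : f t < f x + e.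
      by rewrite -(gK (f x + e))// (halfline_iso_lt fg) ?g0//; near: t; exact: lt_nbhsl.
    by have := f0 t t0; rewrite ltr_norml => *; apply/andP; split; lra.
  have lox : g (f x - e) < x by rewrite -(halfline_iso_lt fg) ?g0// gK; lra.
  near=> t; move=> t0.
  have : f t < f x + e.
    by rewrite -(gK (f x + e))// (halfline_iso_lt fg) ?g0//; near: t; exact: lt_nbhsl.
  have : f x - e < f t.
    by rewrite -(gK (f x - e))// (halfline_iso_lt fg) ?g0//; near: t; exact: lt_nbhsr.
  by rewrite ltr_norml => *; apply/andP; split; lra.
exact: H.
Unshelve. all: by end_near. Qed.

Lemma distortion_functionP eta :
  distortion_function eta <-> exists theta, halfline_iso eta theta.
Proof.
split=> [[theta [fe ft ek tk [ce _]]]|[theta et]]; exists theta; last first.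
  have [e0 t0 ek tk _] := et; split=> //; try exact: halfline_iso_continuous.
  - by move=> x; rewrite inE; exact: ek.
  - by move=> x; rewrite inE; exact: tk.
  - split; first exact: halfline_iso_continuous et.
    exact: halfline_iso_continuous (halfline_iso_sym et).
have eK x : 0 <= x -> theta (eta x) = x by move=> x0; apply: ek; rewrite inE.
have tK x : 0 <= x -> eta (theta x) = x by move=> x0; apply: tk; rewrite inE.
have IE : [set t : R | 0 <= t] = [set` `[0, +oo[].
  by apply/seteqP; split=> t /=; rewrite in_itv/= andbT.
have inI (x : R) : 0 <= x -> x \in `[0, +oo[ by rewrite in_itv/= andbT.
have ce' : {within [set` `[0, +oo[], continuous eta} by rewrite -IE.
have einj : {in `[0, +oo[ &, injective eta}.
  move=> x y; rewrite !in_itv/= !andbT => x0 y0 exy.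
  by rewrite -(eK x x0) exy eK.
split=> [x x0|x x0|x x0|x x0|x y x0 xy]; [exact: fe|exact: ft|exact: eK|exact: tK|].
have y0 : 0 <= y by lra.
have [incr|decr] := itv_continuous_inj_mono ce' einj.
  by apply: incr; rewrite ?inI.
(* A decreasing [eta] would be bounded by [eta 0], yet the value [eta 0 + 1] is attained. *)
have e1 : 0 <= eta 0 + 1 by have /= := fe 0 (lexx 0); lra.
have := ft _ e1; rewrite /= le_eqVlt => /orP[/eqP t1|t1].
  by have := tK _ e1; rewrite -t1; lra.
by have := decr _ _ (inI _ (ltW t1)) (inI _ (lexx 0)) t1; rewrite tK//; lra.
Qed.

Lemma halfline_iso_comp f1 g1 f2 g2 : halfline_iso f1 g1 -> halfline_iso f2 g2 ->
  halfline_iso (f1 \o f2) (g2 \o g1).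
Proof.
move=> [a1 b1 c1 d1 e1] [a2 b2 c2 d2 e2]; split=> [x x0|x x0|x x0|x x0|x y x0 xy] /=.
- exact/a1/a2.
- exact/b2/b1.
- by rewrite c1 ?c2// a2.
- by rewrite d2 ?d1// b1.
- by apply: e1; [exact: a2|exact: e2].
Qed.

(* At [t = 0] the junk value [0^-1 = 0] is the right one. *)
Lemma halfline_iso_inv f g : halfline_iso f g ->
  halfline_iso (fun t => (g t^-1)^-1) (fun t => (f t^-1)^-1).
Proof.
move=> fg; have gf := halfline_iso_sym fg; have [f0 g0 fK gK fl] := fg.
split=> [x x0|x x0|x x0|x x0|x y x0 xy].
- by rewrite invr_ge0 g0// invr_ge0.
- by rewrite invr_ge0 f0// invr_ge0.
- by rewrite invrK gK ?invrK// invr_ge0.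
- by rewrite invrK fK ?invrK// invr_ge0.
- have y0 : 0 < y by lra.
  have gy : 0 < g y^-1 by apply: halfline_iso_gt0 gf _; rewrite invr_gt0.
  move: x0; rewrite le_eqVlt => /orP[/eqP <-|x0].
    by rewrite invr0 (halfline_iso0 gf) invr0 invr_gt0.
  have gx : 0 < g x^-1 by apply: halfline_iso_gt0 gf _; rewrite invr_gt0.
  rewrite ltf_pV2 ?posrE// (halfline_iso_lt gf) ?invr_ge0 1?ltW//.
  by rewrite ltf_pV2 ?posrE.
Qed.

(** For the inverse, the intermediate value theorem is applied on [[0, g1 y]], where [f1 + f2] runs
    from [0] to at least [y]. *)
Lemma halfline_isoD f1 g1 f2 g2 : halfline_iso f1 g1 -> halfline_iso f2 g2 ->
  exists g, halfline_iso (fun t => f1 t + f2 t) g.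
Proof.
move=> i1 i2; have [f10 g10 _ gK1 l1] := i1; have [f20 _ _ _ l2] := i2.
have inc x y : 0 <= x -> x < y -> f1 x + f2 x < f1 y + f2 y.
  by move=> x0 xy; rewrite ltrD ?l1 ?l2.
have ex y : exists x, 0 <= y -> 0 <= x /\ f1 x + f2 x = y.
  have [y0|_] := leP 0 y; last by exists 0.
  have b0 : 0 <= g1 y by exact: g10.
  have cf : {within `[0, g1 y], continuous (fun t => f1 t + f2 t)}.
    have sub : [set` `[0, g1 y]] `<=` [set t : R | 0 <= t].
      by move=> t /=; rewrite in_itv/= => /andP[].
    move=> t; apply: cvgD.
      exact: (continuous_subspaceW sub (halfline_iso_continuous i1)).
    exact: (continuous_subspaceW sub (halfline_iso_continuous i2)).
  have := IVT (v := y) b0 cf.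
  rewrite (halfline_iso0 i1) (halfline_iso0 i2) gK1// addr0.
  have f2b := f20 _ b0.
  rewrite min_l ?max_r ?addr_ge0// => H.
  have [|x] := H; first by rewrite y0/= lerDl.
  by rewrite in_itv/= => /andP[x0 _] xE; exists x.
have [g gP] := choice ex; exists g; split=> [x x0|x x0|x x0|x x0|//].
- by rewrite addr_ge0 ?f10 ?f20.
- by have [] := gP x x0.
- have [] := gP (f1 x + f2 x); first by rewrite addr_ge0 ?f10 ?f20.
  move=> g0 E; have [h|h|//] := ltgtP (g (f1 x + f2 x)) x.
    by have := inc _ _ g0 h; rewrite E ltxx.
  by have := inc _ _ x0 h; rewrite E ltxx.
- by have [] := gP x x0.
Qed.

Lemma halfline_iso_id : halfline_iso id id.
Proof. by split. Qed.

Lemma halfline_iso_scale (k : R) : 0 < k ->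
  halfline_iso (fun t => k * t) (fun t => k^-1 * t).
Proof.
move=> k0; have kn : k != 0 by rewrite gt_eqF.
split=> [x x0|x x0|x x0|x x0|x y x0 xy].
- by rewrite mulr_ge0// ltW.
- by rewrite mulr_ge0// invr_ge0 ltW.
- by rewrite mulKf.
- by rewrite mulVKf.
- by rewrite ltr_pM2l.
Qed.

Lemma halfline_iso_root n : (0 < n)%N ->
  halfline_iso (fun t => t `^ n%:R^-1) (fun t => t ^+ n).
Proof.
move=> n0; have nn : n%:R != 0 :> R by rewrite pnatr_eq0 -lt0n.
split=> [x x0|x x0|x x0|x x0|x y x0 xy].
- exact: powR_ge0.
- exact: exprn_ge0.
- by rewrite -powR_mulrn ?powR_ge0// -powRrM mulVf// powRr1.
- by rewrite -powR_mulrn// -powRrM mulfV// powRr1.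
- by rewrite gt0_ltr_powR// ?invr_gt0 ?ltr0n// nnegrE//; lra.
Qed.

End halfline.

(** * Frink's lemma and sup distances *)

Section chain_metric.
Context {R : realType} {X : Type} (q : X -> X -> R).
Hypothesis q0 : forall x y, q x y = 0 <-> x = y.
Hypothesis qsym : forall x y, q x y = q y x.
Hypothesis qge0 : forall x y, 0 <= q x y.
Hypothesis qweak : forall x y z s, q x y <= s -> q y z <= s -> q x z <= 2 * s.

Let frink_sum (u : nat -> X) (j : nat) := \sum_(l < j) q (u l) (u l.+1).

Let frink_sumS u j : frink_sum u j.+1 = frink_sum u j + q (u j) (u j.+1).
Proof. by rewrite /frink_sum big_ord_recr. Qed.

Let frink_sum_le u i j : (i <= j)%N -> frink_sum u i <= frink_sum u j.
Proof.
move=> /subnK <-; elim: (j - i)%N => [//|k IH].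
by rewrite addSn frink_sumS; apply: le_trans IH _; rewrite lerDl.
Qed.

(* Let [v] be the left-hand side. The chain is cut at the first [k] for which
   [q (u i) (u k)] reaches [v / 2], and both parts contain the link from
   [k - 1] to [k]; counting end links only twice makes their bounds add up. *)
Let frink (n : nat) u i : q (u i) (u (i + n).+2) <=
  4 * (frink_sum u (i + n).+2 - frink_sum u i)
  - 2 * q (u i) (u i.+1) - 2 * q (u (i + n).+1) (u (i + n).+2).
Proof.
elim: n {-2}n (leqnn n) i => [|N IH] n nN i.
  move: nN; rewrite leqn0 => /eqP ->; rewrite addn0 !frink_sumS.
  have := @qweak (u i) (u i.+1) (u i.+2) (q (u i) (u i.+1) + q (u i.+1) (u i.+2)).
  by rewrite lerDl lerDr !qge0 => /(_ isT isT); lra.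
set v := q (u i) _.
have sum_ge : q (u i) (u i.+1) + q (u (i + n).+1) (u (i + n).+2) <=
    frink_sum u (i + n).+2 - frink_sum u i.
  rewrite frink_sumS; have : frink_sum u i.+1 <= frink_sum u (i + n).+1.
    by apply: frink_sum_le; rewrite ltnS leq_addr.
  by rewrite frink_sumS; lra.
have q1 := qge0 (u i) (u i.+1); have q2 := qge0 (u (i + n).+1) (u (i + n).+2).
have split k : v / 2 <= q (u i) (u k) \/ v / 2 <= q (u k) (u (i + n).+2).
  have [h|h] := leP (v / 2) (q (u i) (u k)); first by left.
  right; rewrite leNgt; apply/negP => h'.
  set s := Num.max (q (u i) (u k)) (q (u k) (u (i + n).+2)).
  have sv : s < v / 2 by rewrite gt_max h h'.
  have := @qweak (u i) (u k) (u (i + n).+2) s.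
  by rewrite !le_max !lexx orbT => /(_ isT isT); rewrite -/v; lra.
pose P k := (i < k)%N && (v / 2 <= q (u i) (u k)).
have exP : exists k, P k.
  exists (i + n).+2; rewrite /P !ltnS leqW ?leq_addr//= -/v.
  by have := qge0 (u i) (u (i + n).+2); rewrite -/v; lra.
case: (ex_minnP exP) => k /andP[ik vk] kmin.
(* If the cut comes right after the first link, that link alone is at least [v / 2], and [sum_ge]
   suffices. The last link is treated in the same way below. *)
have [kE|kn] := eqVneq k i.+1; first by rewrite kE in vk; lra.
have {kn}ik1 : (i.+1 < k)%N by rewrite ltn_neqAle eq_sym kn.
have vk1 : v / 2 <= q (u k.-1) (u (i + n).+2).
  have [h|//] := split k.-1.
  have : P k.-1 by rewrite /P h andbT -ltnS prednK// (leq_ltn_trans _ ik).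
  by move=> /kmin; rewrite leqNgt -ltnS prednK ?(leq_ltn_trans _ ik)// ltnSn.
have kle : (k <= (i + n).+2)%N.
  apply: kmin; rewrite /P !ltnS leqW ?leq_addr//= -/v.
  by have := qge0 (u i) (u (i + n).+2); rewrite -/v; lra.
have [kE|kn] := eqVneq k (i + n).+2; first by rewrite kE /= in vk1; lra.
have kle1 : (k <= (i + n).+1)%N by rewrite -ltnS ltn_neqAle kn.
(* With these lengths [k = (i + a).+2]; the second part starts at [(i + a).+1], one before [k], so
   that the two parts share a link. *)
pose a := (k - i.+2)%N; pose b := (n - a.+1)%N.
have kE : k = (i + a).+2 by rewrite /a; lia.
have bE : (i + n)%N = ((i + a).+1 + b)%N by rewrite /b; lia.
have IHa := IH a _ i; have IHb := IH b _ (i + a).+1.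
move: IHa IHb vk vk1; rewrite -bE -kE => IHa IHb vk vk1.
have {}IHa := IHa ltac:(lia); have {}IHb := IHb ltac:(lia).
have Sk := frink_sumS u (i + a).+1.
rewrite -kE in Sk; move: vk1 IHb; rewrite {1}kE /= => vk1 IHb.
lra.
Qed.

(** The cost is an index, which makes concatenation and reversal short inductions; [chain_path]
    recovers the sequence of points for Frink's lemma. *)
Inductive chain (x : X) : X -> R -> Prop :=
| chain_nil : chain x x 0
| chain_rcons y z s : chain x y s -> chain x z (s + q y z).

Lemma chain_ge0 x y s : chain x y s -> 0 <= s.
Proof. by elim=> // {}y z {}s _ s0; rewrite addr_ge0. Qed.

Lemma chain_link x y : chain x y (q x y).
Proof. by rewrite -[q x y]add0r; apply: chain_rcons; exact: chain_nil. Qed.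

Lemma chain_trans x y z s t : chain x y s -> chain y z t -> chain x z (s + t).
Proof.
move=> xy; elim=> [|w v r _ IH]; first by rewrite addr0.
by rewrite addrA; exact: chain_rcons.
Qed.

Lemma chain_sym x y s : chain x y s -> chain y x s.
Proof.
elim=> [|z w {}s _ IH]; first exact: chain_nil.
by rewrite addrC qsym; exact: chain_trans (chain_link _ _) IH.
Qed.

Lemma chain_path x y s : chain x y s -> exists (n : nat) (u : nat -> X),
  [/\ u 0%N = x, u n = y & s = frink_sum u n].
Proof.
elim=> [|z w {}s _ [n [u [u0 un ->]]]].
  by exists 0%N, (fun=> x); split=> //; rewrite /frink_sum big_ord0.
exists n.+1, (fun i => if (i <= n)%N then u i else w); split=> //.
  by rewrite ltnn.
rewrite frink_sumS leqnn ltnn un; congr (_ + _).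
by apply: eq_bigr => i _; rewrite (ltn_ord i) (ltnW (ltn_ord i)).
Qed.

(** Frink's inequality starts at two links, so chains with none or one are separate cases. *)
Lemma chain_ge x y s : chain x y s -> q x y <= 4 * s.
Proof.
move=> xy; have s0 := chain_ge0 xy.
have [n [u [<- <- sE]]] := chain_path xy; move: n sE => [|[|n]] sE.
- have -> : q (u 0%N) (u 0%N) = 0 by exact/q0.
  by rewrite mulr_ge0.
- by move: s0; rewrite sE /frink_sum big_ord_recl big_ord0 addr0 /=; lra.
- have := frink n u 0; rewrite add0n -sE.
  rewrite /frink_sum big_ord0; have := qge0 (u 0%N) (u 1%N).
  by have := qge0 (u n.+1) (u n.+2); lra.
Qed.

Definition chain_metric x y := inf [set s | chain x y s].

Let chain_has_inf x y : has_inf [set s | chain x y s].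
Proof.
split; first by exists (q x y); exact: chain_link.
by exists 0 => s; exact: chain_ge0.
Qed.

Lemma chain_metric_le_cost x y s : chain x y s -> chain_metric x y <= s.
Proof. by move=> xy; apply: ge_inf => //; exists 0 => t; exact: chain_ge0. Qed.

Lemma chain_metric_adherent x y e : 0 < e ->
  exists2 s, chain x y s & s < chain_metric x y + e.
Proof. by move=> e0; exact: inf_adherent e0 (chain_has_inf x y). Qed.

Lemma chain_metric_le x y : chain_metric x y <= q x y.
Proof. exact/chain_metric_le_cost/chain_link. Qed.

Lemma chain_metric_ge x y : q x y <= 4 * chain_metric x y.
Proof.
rewrite -ler_pdivrMl//; apply: lb_le_inf; first by case: (chain_has_inf x y).
by move=> s /chain_ge; rewrite ler_pdivrMl.
Qed.

Lemma chain_metric_ge0 x y : 0 <= chain_metric x y.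
Proof. by have := chain_metric_ge x y; have := qge0 x y; lra. Qed.

Lemma chain_metric_is_metric : is_metric chain_metric.
Proof.
split=> [x y|x y|x y z].
- have qr : q x x = 0 by exact/q0.
  split=> [b0|<-].
    by apply/q0/eqP; rewrite eq_le qge0 andbT; have := chain_metric_ge x y; rewrite b0 mulr0.
  by apply/eqP; rewrite eq_le chain_metric_ge0 andbT -qr chain_metric_le.
- by congr inf; apply/seteqP; split=> s; exact: chain_sym.
- apply/ler_addgt0Pl => e e0; have e20 : 0 < e / 2 by rewrite divr_gt0.
  have [s xy sl] := chain_metric_adherent x y e20.
  have [t yz tl] := chain_metric_adherent y z e20.
  have := chain_metric_le_cost (chain_trans xy yz); lra.
Qed.

(** A chain of cost below [k] has only links of cost below [k]; on these [m] is at most [q], and the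
    triangle inequality for [m] adds them up. *)
Lemma chain_metric_ge_local (m : X -> X -> R) (k : R) x y :
  (forall z, m z z = 0) -> (forall z w v, m z v <= m z w + m w v) ->
  (forall z w, q z w < k -> m z w <= q z w) ->
  chain_metric x y < k -> m x y <= chain_metric x y.
Proof.
move=> m0 mt mq bk.
have H s z : chain x z s -> s < k -> m x z <= s.
  elim=> [|w v t /chain_ge0 t0 IH tk]; first by rewrite m0.
  apply: le_trans (mt x w v) _; apply: lerD; first by apply: IH; have := qge0 w v; lra.
  by apply: mq; lra.
apply/ler_addgt0Pl => e e0.
pose r := Num.min e (k - chain_metric x y).
have r0 : 0 < r by rewrite lt_min e0 subr_gt0.
have [s xy sl] := chain_metric_adherent x y r0.
have re : r <= e by rewrite ge_min lexx.
have rk : r <= k - chain_metric x y by rewrite ge_min lexx orbT.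
by apply: le_trans (H s y xy _) _; lra.
Qed.

End chain_metric.

Section sup_distance.
Context {R : realType} {X : Type}.
Implicit Types f g h : X -> R.

(** Meaningful only for functions at bounded distance, hence the bounds carried by the lemmas
    below. *)
Definition sup_dist f g : R := sup (range (fun z => `|f z - g z|)).

Lemma sup_dist_ge (B : R) f g z : (forall w, `|f w - g w| <= B) ->
  `|f z - g z| <= sup_dist f g.
Proof.
move=> fg; apply: ub_le_sup; last by exists z.
by exists B => _ [w _ <-].
Qed.

Lemma sup_dist_le (B : R) f g (z : X) : (forall w, `|f w - g w| <= B) ->
  sup_dist f g <= B.
Proof.
move=> fg; apply: ge_sup; first by exists `|f z - g z|, z.
by move=> _ [w _ <-].
Qed.

Lemma sup_dist_sym f g : sup_dist f g = sup_dist g f.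
Proof.
rewrite /sup_dist (_ : (fun z => `|f z - g z|) = (fun z => `|g z - f z|))//.
by apply/funext => z; rewrite distrC.
Qed.

Lemma sup_dist_triangle (B C : R) f g h (z : X) :
  (forall w, `|f w - g w| <= B) -> (forall w, `|g w - h w| <= C) ->
  sup_dist f h <= sup_dist f g + sup_dist g h.
Proof.
move=> fg gh; apply: (sup_dist_le z) => w.
have := sup_dist_ge w fg; have := sup_dist_ge w gh.
by have := ler_distD (g w) (f w) (h w); lra.
Qed.

Lemma sup_dist_refl f (z : X) : sup_dist f f = 0.
Proof.
apply/eqP; rewrite eq_le; apply/andP; split.
  by apply: (sup_dist_le z) => w; rewrite subrr normr0.
have {1}<- : `|f z - f z| = 0 by rewrite subrr normr0.
by apply: (@sup_dist_ge 0) => w; rewrite subrr normr0.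
Qed.

End sup_distance.

(** * Growth of quasisymmetries on connected spaces *)

Section quasisymmetric_gauge.
Context {R : realType} {X : Type} (e d : X -> X -> R) (H Hinv : R -> R).
Hypotheses (em : is_metric e) (dm : is_metric d) (Hiso : halfline_iso H Hinv).
Hypothesis qs : forall x y z, x <> z -> d x y <= H (e x y / e x z) * d x z.
Hypothesis middle : forall x w r, 0 <= r <= e x w -> exists z, e x z = r.
Variables (De Dd : R) (p0 p1 : X).
Hypotheses (eD : forall x y, e x y <= De) (dD : forall x y, d x y <= Dd).
Hypothesis p01 : p0 <> p1.

Let e0 := is_metric_ge0 em. Let d0 := is_metric_ge0 dm.
(** Every [x] has a point at distance at least [2 * r0], by [far_point]; so a distance from [x]
    below [r0] can be doubled within the space. *)
Let r0 := e p0 p1 / 4.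
Let r00 : 0 < r0. Proof. by rewrite divr_gt0// is_metric_gt0. Qed.

Let H_ge0 t : 0 <= t -> 0 <= H t. Proof. by case: Hiso => + _ _ _ _; apply. Qed.

Let H_le s t : 0 <= s -> s <= t -> H s <= H t.
Proof. by move=> s0 st; rewrite (halfline_iso_le Hiso)//; lra. Qed.

Let far_point (m : X -> X -> R) x : is_metric m ->
  exists w, m p0 p1 / 2 <= m x w.
Proof.
move=> mm; have := is_metric_triangle mm p0 x p1; rewrite (is_metric_sym mm p0 x).
have [h _|h t] := leP (m p0 p1 / 2) (m x p0); first by exists p0.
by exists p1; lra.
Qed.

(** Some [w] is far from [x] in [d]; comparing [w] with [y] around [x] forbids [d x y] to be
    small. *)
Lemma qs_lower_bound tau : 0 < tau ->
  exists2 m, 0 < m & forall x y, tau <= e x y -> m <= d x y.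
Proof.
move=> t0.
have De0 : 0 < De by apply: lt_le_trans (eD p0 p1); exact: is_metric_gt0.
have HD : 0 < H (De / tau) by apply: halfline_iso_gt0 Hiso _; rewrite divr_gt0.
have d01 : 0 < d p0 p1 by exact: is_metric_gt0.
exists (d p0 p1 / 2 / H (De / tau)); first by rewrite !divr_gt0.
move=> x y txy; have [w wd] := far_point x dm.
have exy : 0 < e x y by lra.
have xy : x <> y by move=> xy; rewrite xy (is_metric_refl em) ltxx in exy.
rewrite ler_pdivrMr// [leRHS]mulrC; apply: le_trans wd _.
apply: le_trans (qs w xy) _; apply: ler_wpM2r => //.
apply: H_le; first by rewrite divr_ge0.
by rewrite ler_pM ?invr_ge0// lef_pV2 ?posrE.
Qed.

(** Here [w] is far from [x] in [e], so [e x y / e x w] is small and [d x y] is a small fraction of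
    the diameter bound [Dd]. *)
Lemma qs_uniformly_continuous k : 0 < k ->
  exists2 tau, 0 < tau & forall x y, e x y < tau -> d x y < k.
Proof.
move=> k0; have Dd0 : 0 < Dd by apply: lt_le_trans (dD p0 p1); exact: is_metric_gt0.
have kD : 0 < k / Dd by rewrite divr_gt0.
have [s s0 Hs] := halfline_iso_small Hiso kD.
exists (s * r0); first by rewrite mulr_gt0.
move=> x y exy; have [w we] := far_point x em.
have r0w : r0 <= e x w by rewrite /r0; have := e0 p0 p1; lra.
have exw : 0 < e x w by apply: lt_le_trans r00 r0w.
have xw : x <> w by move=> xw; rewrite xw (is_metric_refl em) ltxx in exw.
apply: le_lt_trans (qs y xw) _.
have Hlt : H (e x y / e x w) < k / Dd.
  apply: Hs; first by rewrite divr_ge0.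
  by rewrite ltr_pdivrMr//; apply: lt_le_trans exy _; rewrite ler_pM2l.
apply: (@le_lt_trans _ _ (H (e x y / e x w) * Dd)).
  by rewrite ler_wpM2l// H_ge0// divr_ge0.
by rewrite -ltr_pdivlMr.
Qed.

Let K := H 2.
Hypothesis K2 : 2 <= K.
Let K_gt0 : 0 < K. Proof. exact: lt_le_trans K2. Qed.
Let K_ge1 : 1 <= K. Proof. by apply: le_trans K2; rewrite ler1n. Qed.

(* Connectedness lets one double the distance from [x] until it is of unit size,
   at the cost of a factor [K] in [d] each time. *)
Lemma qs_power_bound m j x y : 0 <= m ->
  (forall x y, r0 <= e x y -> m <= d x y) ->
  r0 / 2 ^+ j <= e x y -> m / K ^+ j <= d x y.
Proof.
move=> m0 mP; elim: j y => [|j IH] y.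
  by rewrite !expr0 !divr1; exact: mP.
move=> ry; have K0 := K_gt0; have K1 := K_ge1.
have mK : m / K ^+ j.+1 <= m / K ^+ j.
  rewrite ler_wpM2l// lef_pV2 ?posrE ?exprn_gt0//.
  by rewrite ler_weXn2l.
have [big|small] := leP r0 (e x y).
  apply: (le_trans _ (mP _ _ big)); rewrite ler_pdivrMr ?exprn_gt0//.
  by rewrite ler_peMr// exprn_ege1.
have [w we] := far_point x em.
have [|z zE] := @middle x w (2 * e x y).
  by have exy0 := e0 x y; rewrite /r0 in small; blra.
have exy : 0 < e x y.
  by apply: lt_le_trans ry; rewrite divr_gt0// exprn_gt0.
have xy : x <> y by move=> xy; rewrite xy (is_metric_refl em) ltxx in exy.
have := IH z; rewrite zE => IHz.
have h : r0 / 2 ^+ j <= 2 * e x y.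
  by move: ry; rewrite exprS invfM mulrCA ler_pdivrMl.
have := qs z xy; rewrite zE mulfK ?gt_eqF// -/K => dz.
by rewrite exprS invfM mulrCA ler_pdivrMl//; apply: le_trans (IHz h) dz.
Qed.

Variable n : nat.
Hypotheses (n2 : (2 <= n)%N) (Kn : K ^+ 2 <= 2 ^+ n).
Let rt (t : R) := t `^ n%:R^-1.
Let rtiso : halfline_iso rt (fun t => t ^+ n).
Proof. by apply: halfline_iso_root; exact: ltnW. Qed.

(** Let [i] be least with [r0 / 2 ^+ i <= e x y]; then [d x y >= m / K ^+ i]. In the [n]-th power of
    [L * e x y] the factor [(2 ^+ i) ^+ n] of the denominator is at least [K ^+ i * K ^+ i]: one
    factor meets the bound on [d], the other is at least [2 ^+ i] and absorbs the constants as soon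
    as [i] exceeds [J]. *)
Lemma qs_root_superlinear L : 0 < L ->
  exists2 tau, 0 < tau & forall x y, e x y < tau -> L * e x y <= rt (d x y).
Proof.
move=> L0; have [m m0 mP] := qs_lower_bound r00.
have K0 := K_gt0.
have [J JP] : exists J, (2 * L * r0) ^+ n <= m * 2 ^+ J.
  exists (Num.truncn ((2 * L * r0) ^+ n / m)).+1.
  rewrite [leRHS]mulrC -ler_pdivrMr//; apply: le_trans (ltW (truncnS_gt _)) _.
  by rewrite -natrX ler_nat ltnW// ltn_expl.
exists (r0 / 2 ^+ J); first by rewrite divr_gt0// exprn_gt0.
move=> x y exy; have rt0 : 0 <= rt (d x y) by exact: powR_ge0.
have [e00|epos] := leP (e x y) 0.
  by apply: le_trans rt0; rewrite mulr_ge0_le0// ltW.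
have [i0 i0P] : exists i, r0 / 2 ^+ i <= e x y.
  exists (Num.truncn (r0 / e x y)).+1.
  rewrite ler_pdivrMr ?exprn_gt0// [leRHS]mulrC -ler_pdivrMr//.
  apply: le_trans (ltW (truncnS_gt _)) _.
  by rewrite -natrX ler_nat ltnW// ltn_expl.
have exP : exists i, r0 / 2 ^+ i <= e x y by exists i0.
case: (ex_minnP exP) => i iP imin.
have Ji : (J < i)%N.
  rewrite ltnNge; apply/negP => iJ.
  have : r0 / 2 ^+ J <= r0 / 2 ^+ i.
    rewrite ler_wpM2l ?(ltW r00)// lef_pV2 ?posrE ?exprn_gt0//.
    by rewrite ler_weXn2l// ler1n.
  by move=> h; have := le_trans h iP; rewrite leNgt exy.
have e_lt : e x y < 2 * r0 / 2 ^+ i.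
  rewrite ltNge; apply/negP => h.
  have := imin i.-1; case: i Ji h {iP imin} => // i _ h /=.
  by rewrite ltnn => /(_ _); rewrite exprS invfM mulrACA divff// mul1r in h => /(_ h).
have Le0 : 0 <= L * e x y by rewrite mulr_ge0// ltW.
have dP := qs_power_bound (ltW m0) mP iP.
have [_ _ _ + _] := rtiso => /(_ _ Le0) <-.
rewrite (halfline_iso_le rtiso) ?exprn_ge0//.
apply: le_trans dP.
apply: (@le_trans _ _ ((2 * L * r0 / 2 ^+ i) ^+ n)).
  rewrite lerXn2r ?nnegrE// ?divr_ge0 ?exprn_ge0 ?mulr_ge0 ?(ltW L0) ?(ltW r00)//.
  have -> : 2 * L * r0 / 2 ^+ i = L * (2 * r0 / 2 ^+ i) by rewrite !mulrA [2 * L]mulrC.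
  by rewrite ler_pM2l// ltW.
rewrite expr_div_n ler_pdivrMr ?exprn_gt0// -exprM mulnC exprM.
apply: le_trans JP _; rewrite -mulrA ler_pM2l// mulrC ler_pdivlMr ?exprn_gt0//.
apply: (@le_trans _ _ ((K ^+ 2) ^+ i)); last by rewrite lerXn2r ?nnegrE ?exprn_ge0 ?(ltW K0).
rewrite -exprM mulnC exprM expr2 ler_pM2r ?exprn_gt0//.
apply: (@le_trans _ _ (2 ^+ i)); first by rewrite ler_weXn2l ?ler1n// ltnW.
by rewrite lerXn2r ?nnegrE ?(ltW K0).
Qed.

End quasisymmetric_gauge.

(** * The approximating metrics *)

Section gluing.
Context {R : realType} {X : Type} (e d : X -> X -> R) (n : nat).
Hypotheses (em : is_metric e) (dm : is_metric d) (n2 : (2 <= n)%N).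
Hypothesis doubling :
  forall x y z, e x y <= e y z -> d x z <= 2 ^+ n * d y z.
Let rt (t : R) := t `^ n%:R^-1.
Let rtiso : halfline_iso rt (fun t => t ^+ n).
Proof. by apply: halfline_iso_root; exact: ltnW. Qed.
Let e_ge0 := is_metric_ge0 em.
Let d_ge0 := is_metric_ge0 dm.

Let rt_ge0 t : 0 <= rt t. Proof. exact: powR_ge0. Qed.

Let rt_le s t : 0 <= s -> s <= t -> rt s <= rt t.
Proof. by move=> s0 st; rewrite (halfline_iso_le rtiso)//; lra. Qed.

Let rt_scale t : 0 <= t -> rt (2 ^+ n * t) = 2 * rt t.
Proof.
move=> t0; rewrite /rt powRM ?exprn_ge0//; congr (_ * _).
by have [_ _ _ + _] := rtiso; apply.
Qed.

Let rt_ge t : 0 <= t -> t <= 1 -> t <= rt t.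
Proof.
move=> t0 t1; have [_ _ _ /(_ t t0) {1}<- _] := rtiso.
apply: rt_le; first exact: exprn_ge0.
have -> : n = n.-1.+1 by lia.
by rewrite exprS ler_piMr// exprn_ile1.
Qed.

Variables (delta c tau e1 Dd : R).
Hypotheses (delta0 : 0 < delta) (c0 : 0 < c) (tau0 : 0 < tau).
Hypotheses (e10 : 0 < e1) (e1delta : 4 * e1 <= delta).
Hypothesis dD : forall x y, d x y <= Dd.
Hypothesis near_d : forall x y, e x y < tau -> d x y < e1.
Hypothesis c_large : 8 * Dd <= c * tau.

(** The [8] gives [8 * d <= p] up to scale [delta]. Frink's lemma loses a factor [4], and the
    remaining [2 * d <= b] at distances between [e1] and [delta] is what controls [regularized]. *)
Definition snowflake x y := 8 * delta * rt (d x y / delta).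
Local Notation p := snowflake.
Definition cutoff x y := Num.min (c * e x y) (p x y).
Local Notation q := cutoff.
Local Notation b := (chain_metric q).

Let p_ge0 x y : 0 <= p x y.
Proof. by rewrite mulr_ge0// mulr_ge0// ltW. Qed.

(** Through the root, the factor [2 ^+ n] in [d] becomes the [2] that Frink's lemma allows. *)
Let pP x y z w : d x z <= 2 ^+ n * d y w -> p x z <= 2 * p y w.
Proof.
move=> dd; rewrite /p mulrCA ler_pM2l ?mulr_gt0// -rt_scale ?divr_ge0 ?(ltW delta0)//.
by apply: rt_le; rewrite ?divr_ge0 ?(ltW delta0)// mulrA ler_pM2r ?invr_gt0.
Qed.

Let p_sym x y : p x y = p y x. Proof. by rewrite /p (is_metric_sym dm). Qed.

Let p_eq0 x y : p x y = 0 -> x = y.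
Proof.
move=> /eqP; rewrite /p !mulf_eq0 pnatr_eq0 (gt_eqF delta0)/= => /eqP h.
have [_ _ rtK _ _] := rtiso.
have dd0 : 0 <= d x y / delta by rewrite divr_ge0// ltW.
have := rtK _ dd0; rewrite h expr0n; have -> /= : (n == 0)%N = false by lia.
move=> /esym/eqP; rewrite mulf_eq0 invr_eq0 (gt_eqF delta0) orbF => /eqP.
exact: is_metric_eq0.
Qed.

Let p_ge x y : d x y <= delta -> 8 * d x y <= p x y.
Proof.
move=> dd; rewrite /p -mulrA ler_pM2l// mulrC -ler_pdivrMr//.
by apply: rt_ge; rewrite ?divr_ge0 ?(ltW delta0)// ler_pdivrMr// mul1r.
Qed.

Let q_ge0 x y : 0 <= q x y.
Proof. by rewrite le_min p_ge0 andbT mulr_ge0// ltW. Qed.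

Let q_sym x y : q x y = q y x.
Proof. by rewrite /q p_sym (is_metric_sym em). Qed.

Let q_eq0 x y : q x y = 0 <-> x = y.
Proof.
split=> [|->].
  rewrite /q /Order.min; case: ifP => _; last exact: p_eq0.
  by move=> /eqP; rewrite mulf_eq0 (gt_eqF c0)/= => /eqP; exact: is_metric_eq0.
apply/eqP; rewrite eq_le q_ge0 andbT ge_min.
by rewrite (is_metric_refl em) mulr0 lexx.
Qed.

Let two_le : 2 <= 2 ^+ n :> R.
Proof. by rewrite -[leLHS]expr1 ler_weXn2l ?ler1n//; lia. Qed.

(** When one side is measured by [c * e] and the other by [p], the longer side in [e] decides: if it
    is the one measured by [p], doubling bounds [p] of the third side; if not, both sides are at
    most [s] in [c * e]. *)
Let q_weak x y z s : q x y <= s -> q y z <= s -> q x z <= 2 * s.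
Proof.
have mixed u v w : e u v <= e v w -> p v w <= s -> q u w <= 2 * s.
  move=> /doubling/pP uw vw; rewrite ge_min; apply/orP; right.
  by apply: le_trans uw _; rewrite ler_pM2l.
rewrite ![_ <= s]ge_min => /orP[exy|pxy] /orP[eyz|pyz].
- rewrite ge_min; apply/orP; left.
  have := is_metric_triangle em x y z; rewrite -(ler_pM2l c0); lra.
- have [h|h] := leP (e x y) (e y z); first exact: mixed h pyz.
  rewrite ge_min; apply/orP; left.
  have : c * e y z <= c * e x y by rewrite ler_pM2l// ltW.
  have := is_metric_triangle em x y z; rewrite -(ler_pM2l c0); lra.
- have [h|h] := leP (e y z) (e x y).
    rewrite q_sym; apply: (mixed z y x); last by rewrite p_sym.
    by rewrite (is_metric_sym em z y) (is_metric_sym em y x).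
  rewrite ge_min; apply/orP; left.
  have : c * e x y <= c * e y z by rewrite ler_pM2l// ltW.
  have := is_metric_triangle em x y z; rewrite -(ler_pM2l c0); lra.
- rewrite ge_min; apply/orP; right.
  have t := is_metric_triangle dm x y z.
  have [h|h] := leP (d x y) (d y z).
    have : p x z <= 2 * p y z.
      by apply: pP; have := ler_wpM2r (d_ge0 y z) two_le; lra.
    lra.
  have : p x z <= 2 * p x y.
    by apply: pP; have := ler_wpM2r (d_ge0 x y) two_le; lra.
  lra.
Qed.

Let bm : is_metric b.
Proof. exact: chain_metric_is_metric q_eq0 q_sym q_ge0 q_weak. Qed.

Let b_ge0 := is_metric_ge0 bm.

Let b_le_q x y : b x y <= q x y.
Proof. exact: chain_metric_le. Qed.

Let b_le_e x y : b x y <= c * e x y.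
Proof. by apply: le_trans (b_le_q x y) _; rewrite ge_min lexx. Qed.

Let b_le_p x y : b x y <= p x y.
Proof. by apply: le_trans (b_le_q x y) _; rewrite ge_min lexx orbT. Qed.

Let b_ge x y : q x y <= 4 * b x y.
Proof. exact: chain_metric_ge. Qed.

Let e_far x y : e1 <= d x y -> 8 * d x y <= c * e x y.
Proof.
move=> h; have te : tau <= e x y.
  by rewrite leNgt; apply/negP => /near_d; rewrite ltNge h.
have := dD x y; have : c * tau <= c * e x y by rewrite ler_pM2l.
have := c_large; lra.
Qed.

Let b_far x y : e1 <= d x y -> d x y <= delta -> 2 * d x y <= b x y.
Proof.
move=> h1 h2; have := b_ge x y.
have : 8 * d x y <= q x y by rewrite le_min e_far// p_ge.
lra.
Qed.

(* A [b]-Lipschitz regularisation of [d z] at scale [delta]. *)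
Definition regularized z x :=
  inf [set d z w + b x w | w in [set w | d x w <= delta]].
Local Notation F := regularized.

Let dxx x : d x x <= delta.
Proof. by rewrite (is_metric_refl dm) ltW. Qed.

Let F_le z x w : d x w <= delta -> F z x <= d z w + b x w.
Proof.
move=> xw; apply: ge_inf; last by exists w.
by exists 0 => _ [v _ <-]; rewrite addr_ge0.
Qed.

Let F_ge z x (B : R) : (forall w, d x w <= delta -> B <= d z w + b x w) ->
  B <= F z x.
Proof.
move=> H; apply: lb_le_inf; first by exists (d z x + b x x), x => //=.
by move=> _ [w /H Bw <-].
Qed.

Let F_le_d z x : F z x <= d z x.
Proof. by have := F_le z (dxx x); rewrite (is_metric_refl bm) addr0. Qed.

(** Passing from [x] to [w] lowers the distance to [z] by at most [d x w]; this is below [e1] or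
    else outweighed by the price [b x w]. *)
Let F_ge_d z x : d z x - e1 <= F z x.
Proof.
have E0 := e10; apply: F_ge => w xw; have t := is_metric_triangle dm z w x.
rewrite (is_metric_sym dm w) in t.
have [h|h] := leP e1 (d x w); first by have := b_far h xw; lra.
by have := b_ge0 x w; lra.
Qed.

(** A competitor [w] for [y] within [delta / 2] is also admissible for [x]. A farther one is no
    better than [y] itself, since [d y w <= b y w], and [y] is admissible for [x]. *)
Let F_lip z x y : d x y <= delta / 2 -> F z x - F z y <= b x y.
Proof.
have D0 := delta0; have E1 := e1delta; have E0 := e10.
move=> xy; rewrite lerBlDl -lerBlDr; apply: F_ge => w yw.
have [h|h] := leP (d y w) (delta / 2).
  have := @F_le z x w; have := is_metric_triangle dm x y w.
  have := is_metric_triangle bm x y w; move=> t1 t2 h2.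
  by have := h2 ltac:(lra); lra.
have := @F_le z x y ltac:(lra).
have := b_far (x := y) (y := w) ltac:(lra) yw.
have := is_metric_triangle dm z w y; rewrite (is_metric_sym dm w y).
by have := d_ge0 y w; lra.
Qed.

(** The pseudometric induced by a perturbed Kuratowski embedding: [F^~ x] replaces the function
    giving the distance to [x]. *)
Definition macro x y := sup_dist (F^~ x) (F^~ y).
Local Notation P := macro.

Let F_diff x y z : `|F z x - F z y| <= d x y + e1.
Proof.
have := F_le_d z x; have := F_le_d z y; have := F_ge_d z x; have := F_ge_d z y.
have := is_metric_triangle dm z x y; have := is_metric_triangle dm z y x.
by rewrite (is_metric_sym dm y x) ler_norml => *; apply/andP; split; lra.
Qed.

Let P_le x y : P x y <= d x y + e1.
Proof. exact: (sup_dist_le x) (F_diff x y). Qed.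

Let P_ge x y : d x y - e1 <= P x y.
Proof.
have := sup_dist_ge x (F_diff x y); rewrite /= -/(P x y).
have := F_le_d x x; rewrite (is_metric_refl dm); have := F_ge_d x y.
have := ler_norm (F x y - F x x); rewrite distrC; lra.
Qed.

Let P_le_b x y : d x y <= delta / 2 -> P x y <= b x y.
Proof.
move=> xy; apply: (sup_dist_le x) => z; rewrite ler_norml; apply/andP; split.
  have := @F_lip z y x; rewrite (is_metric_sym dm) (is_metric_sym bm y) => /(_ xy).
  lra.
exact: F_lip.
Qed.

Definition glued x y := Num.max (b x y) (P x y).
Local Notation rho := glued.

Lemma glued_is_metric : is_metric rho.
Proof.
split=> [x y|x y|x y z].
- split=> [h|->].
    apply: (is_metric_eq0 bm); apply/eqP; rewrite eq_le b_ge0 andbT -h.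
    by rewrite le_max lexx.
  by rewrite /rho (is_metric_refl bm) /P (sup_dist_refl _ y) maxxx.
- by rewrite /rho (is_metric_sym bm) /P sup_dist_sym.
- rewrite ge_max; apply/andP; split.
    apply: le_trans (is_metric_triangle bm x y z) _.
    by apply: lerD; rewrite le_max lexx.
  apply: le_trans (sup_dist_triangle x (F_diff x y) (F_diff y z)) _.
  by apply: lerD; rewrite le_max lexx orbT.
Qed.

Lemma glued_close x y : d x y - e1 <= rho x y <= Num.max (p x y) (d x y + e1).
Proof.
rewrite le_max P_ge orbT /= ge_max !le_max b_le_p P_le.
by rewrite orbT.
Qed.

Let Q x y := Num.min (c * e x y) (d x y + p x y).

(** Beyond [delta / 2] one has [P <= d + e1 <= 2 * d], while [8 * d <= c * e]; up to that scale [P]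
    is at most [b]. *)
Lemma glued_le x y : rho x y <= 2 * Q x y.
Proof.
have D0 := delta0; have E1 := e1delta; have E0 := e10.
have bQ : b x y <= Q x y.
  apply: le_trans (b_le_q x y) _; rewrite le_min !ge_min lexx/=.
  by rewrite lerDr d_ge0 orbT.
have := b_ge0 x y; rewrite ge_max => b0; apply/andP; split; first lra.
have [h|h] := leP (d x y) (delta / 2); first by have := P_le_b h; lra.
have h1 : e1 <= d x y by lra.
have := P_le x y; have := e_far h1; have := p_ge0 x y => p0 ed Pd.
have : P x y / 2 <= Q x y by rewrite le_min; apply/andP; split; lra.
lra.
Qed.

(** Up to scale [delta] the term [d] is dominated by [p], and [b] alone suffices. Beyond it
    [P >= d - e1] controls [d], while [b] still controls [min (c * e, p)]. *)
Lemma glued_ge x y : Q x y <= 8 * rho x y.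
Proof.
have D0 := delta0; have E1 := e1delta; have E0 := e10.
have bq := b_ge x y.
have br : b x y <= rho x y by rewrite le_max lexx.
have Pr : P x y <= rho x y by rewrite le_max lexx orbT.
have [h|h] := leP (d x y) delta.
  have := p_ge h; have := p_ge0 x y; have := d_ge0 x y => dx px pg.
  have : Q x y <= 2 * q x y.
    rewrite /q /Q; have := mulr_ge0 (ltW c0) (e_ge0 x y) => ce.
    rewrite ge_min; case: (leP (c * e x y) (p x y)) => h2; apply/orP; [left|right]; lra.
  lra.
have Pg := P_ge x y.
have [h2|h2] := leP (c * e x y) (p x y).
  have qE : q x y = c * e x y by rewrite /cutoff min_l.
  rewrite ge_min; apply/orP; left; have := b_ge0 x y; lra.
have qE : q x y = p x y by rewrite /cutoff min_r// ltW.
rewrite ge_min; apply/orP; right; lra.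
Qed.

(** The three summands bound the ratios of [c * e], [d] and [p]. The factor [16] is the product of
    the comparison constants [2] and [8] between [rho] and [Q]. *)
Lemma glued_ratio H Hinv x y z : halfline_iso H Hinv ->
  (forall x y z, x <> z -> d x y <= H (e x y / e x z) * d x z) ->
  x <> z ->
  rho x y <= 16 * ((e x y / e x z) + (H (e x y / e x z) + rt (H (e x y / e x z))))
    * rho x z.
Proof.
move=> Hiso qs xz.
set t := e x y / e x z; set h := H t.
have exz : 0 < e x z by exact: is_metric_gt0.
have t0 : 0 <= t by rewrite divr_ge0// ltW.
have h0 : 0 <= h by case: Hiso => + _ _ _ _; apply.
have rh0 := rt_ge0 h.
have dh : d x y <= h * d x z by exact: qs.
have ph : p x y <= rt h * p x z.
  rewrite /p mulrCA ler_pM2l ?mulr_gt0//.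
  apply: (@le_trans _ _ (rt (h * (d x z / delta)))).
    by apply: rt_le; rewrite ?divr_ge0 ?(ltW delta0)// mulrA ler_pM2r ?invr_gt0.
  by rewrite /rt powRM// divr_ge0// ltW.
have et : e x y = t * e x z by rewrite /t divfK ?gt_eqF.
have hd : h * d x z >= 0 by rewrite mulr_ge0.
have cez : 0 <= c * e x z by rewrite mulr_ge0// ltW.
have dpz : 0 <= d x z + p x z by rewrite addr_ge0.
set s := t + (h + rt h).
have s0 : 0 <= s by rewrite !addr_ge0.
have QQ : Q x y <= s * Q x z.
  rewrite /Q minr_pMr// le_min; apply/andP; split.
    apply: le_trans (_ : c * e x y <= _); first by rewrite ge_min lexx.
    by rewrite et mulrCA ler_wpM2r// /s lerDl addr_ge0.
  apply: le_trans (_ : d x y + p x y <= _); first by rewrite ge_min lexx orbT.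
  have := mulr_ge0 t0 dpz.
  have := mulr_ge0 h0 (p_ge0 x z); have := mulr_ge0 rh0 (d_ge0 x z).
  by rewrite /s !mulrDl !mulrDr; lra.
apply: le_trans (glued_le x y) _.
have := ler_wpM2l s0 (glued_ge x z); lra.
Qed.

Variables (s0 m : R).
Hypotheses (s00 : 0 < s0) (m0 : 0 < m).
Hypothesis p_large : forall x y, e x y < s0 -> c * e x y <= p x y.
Hypothesis d_large : forall x y, s0 <= e x y -> m <= d x y.

(** Two implications, because a local isometry must match the balls of the two metrics in both
    directions. *)
Lemma glued_local : exists2 k, 0 < k &
  forall x y, (c * e x y < k -> rho x y = c * e x y) /\
              (rho x y < k -> rho x y = c * e x y).
Proof.
have D0 := delta0; have E1 := e1delta; have E0 := e10.
(* A lower bound for [q] at pairs with [s0 <= e x y]; below it, [q] is therefore [c * e]. *)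
pose k1 := Num.min (c * s0) (8 * delta * rt (m / delta)).
(* Below [c * tau] also [d x y < e1 <= delta / 4], which puts [P] under [b]. *)
pose k2 := Num.min k1 (c * tau).
have k10 : 0 < k1.
  rewrite lt_min !mulr_gt0//.
  by apply: (halfline_iso_gt0 rtiso); rewrite divr_gt0.
have k20 : 0 < k2 by rewrite lt_min k10 mulr_gt0.
have small x y : q x y < k1 -> c * e x y <= q x y.
  move=> qk; rewrite le_min lexx /=.
  have [h|h] := ltP (e x y) s0; first exact: p_large.
  move: qk; rewrite ltNge => /negP[]; rewrite le_min !ge_min.
  rewrite ler_pM2l// h /=; apply/orP; right.
  rewrite ler_pM2l ?mulr_gt0//; apply: rt_le; first by apply: divr_ge0; exact: ltW.
  by rewrite ler_pM2r ?invr_gt0// d_large.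
have bE x y : b x y < k1 -> b x y = c * e x y.
  move=> bk; apply/eqP; rewrite eq_le b_le_e /=.
  apply: (chain_metric_ge_local q_ge0 (m := fun x y => c * e x y) _ _ small bk).
    by move=> z; rewrite (is_metric_refl em) mulr0.
  by move=> z w v; rewrite -mulrDr ler_pM2l// is_metric_triangle.
have k21 : k2 <= k1 by rewrite ge_min lexx.
have rhoE x y : c * e x y < k2 -> rho x y = c * e x y.
  move=> ck.
  have bk : b x y < k1 by have := b_le_e x y; lra.
  have : e x y < tau.
    by rewrite -(ltr_pM2l c0); apply: lt_le_trans ck _; rewrite ge_min lexx orbT.
  move=> /near_d dxy; have Pb : P x y <= b x y by apply: P_le_b; lra.
  by rewrite /glued max_l//; exact: bE.
exists k2 => // x y; split; first exact: rhoE.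
move=> rk; have br : b x y <= rho x y by rewrite le_max lexx.
have bk : b x y < k1 by lra.
by apply: rhoE; rewrite -(bE x y bk); exact: le_lt_trans br rk.
Qed.

End gluing.

(** The usual distortion of an inverse quasisymmetry, [t |-> 1 / g (1 / t)] with [g] inverse to [f],
    at the level of ratios. *)
Lemma halfline_iso_ratio_inv (R : realType) (f g : R -> R) (a b a' b' : R) :
  halfline_iso f g -> 0 < a -> 0 < b -> 0 < a' -> 0 < b' ->
  a' / b' <= f (a / b) -> b / a <= (g (b' / a')^-1)^-1.
Proof.
move=> fg a0 b0 a'0 b'0 h; have gf := halfline_iso_sym fg.
have ab : 0 < a / b by rewrite divr_gt0.
have ab' : 0 < a' / b' by rewrite divr_gt0.
rewrite invf_div -[leLHS]invf_div lef_pV2 ?posrE//; last exact: halfline_iso_gt0 gf _.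
have [_ _ gK _ _] := fg; rewrite -(gK (a / b)) ?(ltW ab)//.
by rewrite (halfline_iso_le gf) ?(ltW ab')//; exact/ltW/(halfline_iso_gt0 fg).
Qed.

(** * Choice of the parameters *)

Section approximation.
Context {R : realType} (H Hinv : R -> R) (n : nat).
Hypotheses (Hiso : halfline_iso H Hinv) (n2 : (2 <= n)%N) (H2 : 2 <= H 2).
Hypotheses (H2n : H 2 ^+ 2 <= 2 ^+ n) (H1n : 1 + H 1 <= 2 ^+ n).

Definition approximation_distortion (t : R) : R :=
  16 * (t + (H t + (H t) `^ n%:R^-1)).

Lemma approximation_distortion_iso :
  exists g, halfline_iso approximation_distortion g.
Proof.
have rtiso : halfline_iso (fun t : R => t `^ n%:R^-1) (fun t => t ^+ n).
  by apply: halfline_iso_root; exact: ltnW.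
have [g1 i1] := halfline_isoD Hiso (halfline_iso_comp rtiso Hiso).
have [g2 i2] := halfline_isoD halfline_iso_id i1.
have s0 : (0 : R) < 16 by [].
by eexists; exact: halfline_iso_comp (halfline_iso_scale s0) i2.
Qed.

Lemma approximating_metric (X : Type) (e d : X -> X -> R) (De Dd : R)
    (p0 p1 : X) : is_metric e -> is_metric d ->
  (forall x y z, x <> z -> d x y <= H (e x y / e x z) * d x z) ->
  (forall x w r, 0 <= r <= e x w -> exists z, e x z = r) ->
  (forall x y, e x y <= De) -> (forall x y, d x y <= Dd) -> p0 <> p1 ->
  forall eps, 0 < eps -> exists c (rho : X -> X -> R) k,
    [/\ 0 < c, 0 < k, is_metric rho,
      forall x y, (c * e x y < k -> rho x y = c * e x y) /\
                  (rho x y < k -> rho x y = c * e x y)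
      & (forall x y, `|rho x y - d x y| <= eps) /\
        (forall x y z, x <> z ->
          rho x y <= approximation_distortion (e x y / e x z) * rho x z)].
Proof.
move=> em dm qs middle eD dD p01 eps eps0.
have doubling x y z : e x y <= e y z -> d x z <= 2 ^+ n * d y z.
  move=> exy; have [yz|yz] := pselect (y = z).
    move: exy; rewrite yz (is_metric_refl em) => h.
    have -> : x = z.
      by apply: (is_metric_eq0 em); apply/eqP; rewrite eq_le h is_metric_ge0.
    by rewrite (is_metric_refl dm) mulr0.
  have eyz : 0 < e y z by exact: is_metric_gt0.
  have : H (e y x / e y z) <= H 1.
    rewrite (halfline_iso_le Hiso)// ?divr_ge0 ?is_metric_ge0//.
    by rewrite ler_pdivrMr// mul1r (is_metric_sym em).
  have dyz := is_metric_ge0 dm y z.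
  move=> /(ler_wpM2r dyz) h1; have := ler_wpM2r dyz H1n; have := qs y x z yz.
  have := is_metric_triangle dm x y z; rewrite (is_metric_sym dm x y) mulrDl mul1r.
  lra.
have Dd0 : 0 <= Dd by apply: le_trans (dD p0 p1); exact: is_metric_ge0.
have D1 : 0 < 8 ^+ n * (Dd + 1) by rewrite mulr_gt0 ?exprn_gt0//; lra.
(* Makes [p <= eps] everywhere: this amounts to [d * 8 ^+ n * delta ^+ n <= delta * eps ^+ n], and
   [delta ^+ n <= delta * delta] because [delta <= 1] and [2 <= n]. *)
pose delta := Num.min 1 (eps ^+ n / (8 ^+ n * (Dd + 1))).
have delta0 : 0 < delta by rewrite lt_min ltr01 divr_gt0 ?exprn_gt0.
have delta1 : delta <= 1 by rewrite ge_min lexx.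
have deltaE : delta * (8 ^+ n * (Dd + 1)) <= eps ^+ n.
  by rewrite -ler_pdivlMr// ge_min lexx orbT.
have rtiso : halfline_iso (fun t : R => t `^ n%:R^-1) (fun t => t ^+ n).
  by apply: halfline_iso_root; exact: ltnW.
have p_small x y : snowflake d n delta x y <= eps.
  have d0 := is_metric_ge0 dm x y.
  have e8 : 0 <= eps / (8 * delta) by apply: divr_ge0; apply: ltW => //; rewrite mulr_gt0.
  rewrite /snowflake mulrC -ler_pdivlMr ?mulr_gt0//.
  have [_ _ _ /(_ _ e8) <- _] := rtiso.
  have dd0 : 0 <= d x y / delta by rewrite divr_ge0// ltW.
  rewrite (halfline_iso_le rtiso dd0 (exprn_ge0 n e8)).
  rewrite expr_div_n ler_pdivrMr// mulrAC ler_pdivlMr ?exprn_gt0 ?mulr_gt0//.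
  rewrite exprMn; have dn : delta ^+ n <= delta * delta.
    have -> : n = (n - 2).+2 by rewrite -addn2 subnK.
    rewrite !exprS mulrA ler_piMr ?mulr_ge0 ?(ltW delta0)//.
    by rewrite exprn_ile1 ?(ltW delta0).
  apply: (@le_trans _ _ ((Dd + 1) * (8 ^+ n * (delta * delta)))).
    apply: ler_pM => //; first by rewrite mulr_ge0 ?exprn_ge0 ?(ltW delta0).
      by have := dD x y; lra.
    by rewrite ler_wpM2l ?exprn_ge0.
  have -> : (Dd + 1) * (8 ^+ n * (delta * delta)) =
    delta * (8 ^+ n * (Dd + 1)) * delta by ring.
  by rewrite ler_wpM2r// ltW.
pose e1 := Num.min (delta / 4) eps.
have e10 : 0 < e1 by rewrite lt_min eps0 divr_gt0.
have e1d : 4 * e1 <= delta.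
  have : e1 <= delta / 4 by rewrite ge_min lexx.
  lra.
have e1e : e1 <= eps by rewrite ge_min lexx orbT.
have [tau tau0 near_d] := qs_uniformly_continuous em dm Hiso qs dD p01 e10.
pose c := 8 * (Dd + 1) / tau.
have c0 : 0 < c by rewrite divr_gt0// mulr_gt0//; lra.
have c_large : 8 * Dd <= c * tau.
  by rewrite /c divfK ?gt_eqF//; lra.
(* With this slope [L * e <= rt d] says exactly [c * e <= p]. *)
pose L := c / (8 * delta * (delta^-1) `^ n%:R^-1).
have rtd : 0 < delta^-1 `^ n%:R^-1 by rewrite powR_gt0// invr_gt0.
have L0 : 0 < L by rewrite divr_gt0// !mulr_gt0.
have [s0 s00 sup] := qs_root_superlinear em dm Hiso qs middle eD p01 H2 n2 H2n L0.
have p_large x y : e x y < s0 -> c * e x y <= snowflake d n delta x y.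
  move=> /sup; rewrite /snowflake powRM ?is_metric_ge0 ?invr_ge0 ?(ltW delta0)//.
  rewrite /L mulrAC ler_pdivrMr ?mulr_gt0// => /le_trans; apply.
  by rewrite mulrCA.
have [m m0 d_large] := qs_lower_bound em dm Hiso qs eD p01 s00.
have [k k0 loc] := glued_local em dm n2 doubling delta0 c0 tau0 e10 e1d dD near_d
  c_large s00 m0 p_large d_large.
exists c, (glued e d n delta c), k; split; [exact: c0|exact: k0| |exact: loc|].
  exact: (glued_is_metric em dm n2 doubling delta0 c0 tau0 e10 e1d dD near_d c_large).
split=> [x y|x y z xz].
  have := glued_close em dm n2 doubling delta0 c0 tau0 e10 e1d dD near_d c_large x y.
  move=> /andP[lo]; rewrite le_max => /orP hi.
  have := p_small x y; have := is_metric_ge0 dm x y => d0 ps.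
  by rewrite ler_norml; apply/andP; split; [lra|case: hi; lra].
exact: (glued_ratio em dm n2 doubling delta0 c0 tau0 e10 e1d dD near_d c_large
  y Hiso qs xz).
Qed.

End approximation.

(** * Gromov-Hausdorff distance *)

Section gromov_hausdorff.
Context {R : realType}.

Lemma hausdorff_distance_le (Z : Type) (d : Z -> Z -> R) (A B : set Z) (r : R) :
  0 < r -> (forall a, A a -> exists2 b, B b & d a b < r) ->
  (forall b, B b -> exists2 a, A a & d b a < r) ->
  (hausdorff_distance d A B <= r%:E)%E.
Proof. by move=> r0 AB BA; apply: ereal_inf_lbound; exists r. Qed.

Lemma gromov_hausdorff_distance_ge0 (X Y : Type) (dX : X -> X -> R)
  (dY : Y -> Y -> R) : (0 <= gromov_hausdorff_distance dX dY)%E.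
Proof.
apply: le_ereal_inf_tmp => _ [Z [dZ [i [j [_ _ _ ->]]]]].
by apply: le_ereal_inf_tmp => _ [r [r0 _ _] <-]; rewrite lee_fin ltW.
Qed.

Lemma gromov_hausdorff_distance_isometric_le (X : Type) (d1 d2 : X -> X -> R)
    (r : R) : is_metric d2 -> (forall x y, d1 x y = d2 x y) -> 0 < r ->
  (gromov_hausdorff_distance d1 d2 <= r%:E)%E.
Proof.
move=> dm dE r0.
apply: (@le_trans _ _ (hausdorff_distance d2 (range id) (range id))).
  by apply: ereal_inf_lbound; exists X, d2, id, id; split=> // x x'; rewrite dE.
by apply: hausdorff_distance_le => // x _; exists x;
  [exists x|rewrite (is_metric_refl dm)|exists x|rewrite (is_metric_refl dm)].
Qed.

(* Both spaces are embedded in the bounded functions on [X] by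
   [x |-> dX x] and [y |-> dY y \o f]. *)
Lemma gromov_hausdorff_distance_le (X Y : Type) (dX : X -> X -> R)
    (dY : Y -> Y -> R) (f : X -> Y) (h : Y -> X) (x0 : X) (BX BY e r : R) :
  is_metric dX -> is_metric dY -> cancel h f ->
  (forall x y, dX x y <= BX) -> (forall x y, dY x y <= BY) ->
  (forall x y, `|dX x y - dY (f x) (f y)| <= e) -> e < r ->
  (gromov_hausdorff_distance dX dY <= r%:E)%E.
Proof.
move=> mX mY hK bX bY close er.
pose Z := {u : X -> R | exists B, forall x, `|u x| <= B}.
pose dZ (u v : Z) := sup_dist (sval u) (sval v).
have bnd (u v : Z) : exists B, forall x, `|sval u x - sval v x| <= B.
  have [B uB] := svalP u; have [C vC] := svalP v; exists (B + C) => x.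
  by apply: le_trans (ler_normB _ _) _; rewrite lerD.
have mZ : is_metric dZ.
  split=> [u v|u v|u v w].
  - split=> [uv|->]; last exact: (sup_dist_refl _ x0).
    have [B uvB] := bnd u v.
    case: u v uv uvB => [u pu] [v pv] /= uv uvB; apply: eq_exist.
    apply/funext => x; apply/eqP; rewrite -subr_eq0 -normr_le0 -uv.
    exact: sup_dist_ge uvB.
  - exact: sup_dist_sym.
  - have [B uvB] := bnd u v; have [C vwC] := bnd v w.
    exact: (sup_dist_triangle x0 uvB vwC).
have pi x : exists B, forall z, `|dX x z| <= B.
  by exists BX => z; rewrite ger0_norm// is_metric_ge0.
have pj y : exists B, forall z, `|dY y (f z)| <= B.
  by exists BY => z; rewrite ger0_norm// is_metric_ge0.
pose i x : Z := exist _ (dX x) (pi x).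
pose j y : Z := exist _ (dY y \o f) (pj y).
have iso (T : Type) (dT : T -> T -> R) x x' z : is_metric dT ->
    `|dT x z - dT x' z| <= dT x x'.
  move=> mT; have := is_metric_triangle mT x x' z.
  have := is_metric_triangle mT x' x z; rewrite (is_metric_sym mT x' x).
  by rewrite ler_norml => *; apply/andP; split; lra.
have iE x x' : dZ (i x) (i x') = dX x x'.
  apply/eqP; rewrite eq_le; apply/andP; split.
    by apply: (sup_dist_le x0) => z; exact: iso.
  have := @sup_dist_ge _ _ (dX x x') (dX x) (dX x') x' (fun w => iso _ _ _ _ _ mX).
  by rewrite (is_metric_refl mX) subr0 ger0_norm// is_metric_ge0.
have jE y y' : dZ (j y) (j y') = dY y y'.
  apply/eqP; rewrite eq_le; apply/andP; split.
    by apply: (sup_dist_le x0) => z; exact: iso.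
  have := @sup_dist_ge _ _ (dY y y') (dY y \o f) (dY y' \o f) (h y')
    (fun w => iso _ _ _ _ _ mY).
  by rewrite /= hK (is_metric_refl mY) subr0 ger0_norm// is_metric_ge0.
have r0 : 0 < r by apply: le_lt_trans er; apply: le_trans (close x0 x0).
apply: (@le_trans _ _ (hausdorff_distance dZ (range i) (range j))).
  by apply: ereal_inf_lbound; exists Z, dZ, i, j.
have ij x : dZ (i x) (j (f x)) < r.
  by apply: le_lt_trans er; apply: (sup_dist_le x0) => z; exact: close.
apply: hausdorff_distance_le => // [_ [x _ <-]|_ [y _ <-]].
  by exists (j (f x)) => //; exists (f x).
exists (i (h y)); first by exists (h y).
by rewrite (is_metric_sym mZ) -{2}(hK y).
Qed.

Lemma gromov_hausdorff_cvg0 (X Y : Type) (dX : nat -> X -> X -> R)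
    (dY : Y -> Y -> R) :
  (forall k, (gromov_hausdorff_distance (dX k) dY <= (2 * k.+1%:R^-1)%:E)%E) ->
  gromov_hausdorff_distance (dX k) dY @[k --> \oo] --> 0%E.
Proof.
move=> H; apply: (@squeeze_cvge _ _ _ _ (cst 0%E) _ (fun k => (2 * k.+1%:R^-1)%:E)).
- by near=> k; rewrite gromov_hausdorff_distance_ge0 H.
- exact: cvg_cst.
- apply: cvg_EFin; first by near=> k.
  rewrite -[X in _ --> X](mulr0 2); apply: cvgMl_tmp.
  exact: cvg_harmonic.
Unshelve. all: by end_near. Qed.

End gromov_hausdorff.

(** * From a quasisymmetry to approximating metrics *)

Section quasisymmetric_implies_approximation.
Context {R : realType}.

Lemma induced_metric (X Y : Type) (d : Y -> Y -> R) (f : X -> Y) :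
  injective f -> is_metric d -> is_metric (fun x y => d (f x) (f y)).
Proof.
move=> finj dm; split=> [x y|x y|x y z].
- by split=> [/(is_metric_eq0 dm)/finj|->]; last exact: is_metric_refl.
- exact: is_metric_sym.
- exact: is_metric_triangle.
Qed.

Lemma dhomeomorphism_id (X : Type) (d1 d2 : X -> X -> R) (c k : R) :
  0 < c -> 0 < k ->
  (forall x y, (c * d1 x y < k -> d2 x y = c * d1 x y) /\
               (d2 x y < k -> d2 x y = c * d1 x y)) ->
  dhomeomorphism d2 d1 id.
Proof.
move=> c0 k0 loc; exists id; split=> // x r r0.
- exists (Num.min k (c * r)); first by rewrite lt_min k0 mulr_gt0.
  move=> _ [y /= + <-]; rewrite /dball /= lt_min => /andP[yk yr].
  by have [_ /(_ yk) E] := loc x y; move: yr; rewrite E ltr_pM2l.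
- exists (Num.min (k / c) (r / c)); first by rewrite lt_min !divr_gt0.
  move=> _ [y /= + <-]; rewrite /dball /= lt_min !ltr_pdivlMr// ![_ * c]mulrC.
  by move=> /andP[yk yr]; have [/(_ yk) -> _] := loc x y.
Qed.

Lemma locally_isometric_scaled (X : Type) (e d1 d2 : X -> X -> R) (c k : R) :
  is_metric e -> 0 < c -> 0 < k -> (forall x y, d1 x y = c * e x y) ->
  (forall x y, (c * e x y < k -> d2 x y = c * e x y) /\
               (d2 x y < k -> d2 x y = c * e x y)) ->
  locally_isometric d1 d2.
Proof.
move=> em c0 k0 d1E loc x; exists (k / 2); first by rewrite divr_gt0.
have k2 : k / 2 < k by lra.
split=> [|y z].
  apply/seteqP; split=> y; rewrite /dball /= d1E => h.
    by have [-> //] := loc x y; exact: lt_trans h k2.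
  by have [_ <- //] := loc x y; exact: lt_trans h k2.
rewrite /dball /= !d1E => xy xz; have [-> //] := loc y z.
have := is_metric_triangle em y x z; rewrite (is_metric_sym em y x).
by rewrite -(ler_pM2l c0); lra.
Qed.

Lemma induces_topology_nbhs (X : topologicalType) (d : X -> X -> R) x r :
  induces_topology d -> 0 < r -> nbhs x (dball d x r).
Proof. by move=> dt r0; apply/dt; exists r. Qed.

Lemma quasisymmetry_separates (X : topologicalType) (M : smooth_surface X)
    (g : riemannian_metric M) (Y : Type) (dY : Y -> Y -> R) f :
  is_metric dY -> dhomeomorphism (intrinsic_metric g) dY f ->
  forall x y, intrinsic_metric g x y = 0 -> x = y.
Proof.
move=> dm [h [fK _ fc _]] x y exy.
by rewrite -(fK x) (dcontinuous_eq0 dm fc exy) fK.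
Qed.

Theorem quasisymmetric_implies_approximation (eta : R -> R) :
  distortion_function eta ->
  exists2 eta' : R -> R, distortion_function eta' &
    forall (X : topologicalType) (M : smooth_surface X)
      (g : riemannian_metric M) (dX : X -> X -> R),
      compact [set: X] -> connected [set: X] ->
      is_metric dX -> induces_topology dX ->
      quasisymmetric_to eta (intrinsic_metric g) dX ->
      exists (gs : nat -> riemannian_metric M) (ds : nat -> X -> X -> R),
        uniform_approximation g dX eta' gs ds.
Proof.
move=> /distortion_functionP[theta et].
have [eta0 _ _ _ _] := et.
(* Adding the identity to [eta] ensures [2 <= H 2] and [1 <= H 1]; the latter extends the estimate
   to [y = z]. *)
have [Hinv Hiso] := halfline_isoD (@halfline_iso_id R) et.
set H := (fun t => _) in Hiso.
have H2 : 2 <= H 2 by rewrite /H lerDl eta0.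
have H1 : 1 <= H 1 by rewrite /H lerDl eta0.
pose n := (Num.truncn (H 2 ^+ 2 + (1 + H 1))).+2.
have H20 : 0 <= H 2 ^+ 2 by rewrite exprn_ge0//; lra.
have nP : H 2 ^+ 2 + (1 + H 1) <= 2 ^+ n.
  apply: le_trans (ltW (truncnS_gt _)) _.
  by rewrite -natrX ler_nat ltnW// (leq_trans _ (ltn_expl n (leqnn _)))//.
have n2 : (2 <= n)%N by [].
have H2n : H 2 ^+ 2 <= 2 ^+ n by lra.
have H1n : 1 + H 1 <= 2 ^+ n by lra.
have [g0 i0] := approximation_distortion_iso Hiso n2.
exists (fun t => (g0 t^-1)^-1).
  by apply/distortion_functionP; eexists; exact: halfline_iso_inv i0.
move=> X M g dX Xc Xn mX tX [f [fh fqs]].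
have sep := quasisymmetry_separates mX fh.
pose e := intrinsic_metric g.
have em : is_metric e := intrinsic_is_metric sep.
have enb x r : 0 < r -> nbhs x (dball e x r) by move=> r0; exact: (intrinsic_metric_nbhs sep x r0).
have [h [fK hK _ _]] := fh.
(* The gauge estimates need two distinct points; on a space with at most one point the constant
   sequence works. *)
have [[p0 [p1 p01]]|trivial] := pselect (exists p0 p1 : X, p0 <> p1); last first.
  have all_eq (x y : X) : x = y.
    by have [//|xy] := pselect (x = y); case: trivial; exists x, y.
  exists (fun=> g), (fun=> e); split=> [k|k x||k].
  - exact: em.
  - by exists 1.
  - apply: gromov_hausdorff_cvg0 => k.
    apply: gromov_hausdorff_distance_isometric_le => // x y.
    by rewrite (all_eq x y) (is_metric_refl mX); exact: is_metric_refl.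
  - exists id; split; last by move=> x y z xy; case: xy; exact: all_eq.
    by exists id; split=> // x r r0; exists r => // _ [y yr <-].
pose d x y := dX (f x) (f y).
have dm : is_metric d by exact: induced_metric (can_inj fK) mX.
have qs x y z : x <> z -> d x y <= H (e x y / e x z) * d x z.
  move=> xz; have exz : 0 < e x z by exact: is_metric_gt0.
  have dxz : 0 < d x z by exact: is_metric_gt0.
  have t0 : 0 <= e x y / e x z by rewrite divr_ge0 ?is_metric_ge0.
  have [->|xy] := pselect (y = x).
    rewrite (is_metric_refl dm) mulr_ge0 ?(ltW dxz)//.
    by rewrite (is_metric_refl em) mul0r (halfline_iso0 Hiso).
  have [->|yz] := pselect (y = z); first by rewrite divff ?gt_eqF// ler_peMl// ltW.
  have xy' : x <> y by move=> xy'; apply: xy.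
  have := fqs x y z xy' xz yz; rewrite ler_pdivrMr// => /le_trans; apply.
  by rewrite ler_wpM2r ?(ltW dxz)// /H lerDr.
have middle x w r : 0 <= r <= e x w -> exists z, e x z = r.
  by move=> rw; exact: (metric_intermediate em enb Xn rw).
have [De eD] := metric_bounded em Xc enb.
have [Dd dD0] := metric_bounded mX Xc (fun x r => @induces_topology_nbhs X dX x r tX).
have dD x y : d x y <= Dd by exact: dD0.
have approx (k : nat) : exists gd : riemannian_metric M * (X -> X -> R),
    exists c s, [/\ 0 < c /\ (forall x y, intrinsic_metric gd.1 x y = c * e x y),
      0 < s, is_metric gd.2,
      forall x y, (c * e x y < s -> gd.2 x y = c * e x y) /\
                  (gd.2 x y < s -> gd.2 x y = c * e x y)
      & (forall x y, `|gd.2 x y - d x y| <= k.+1%:R^-1) /\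
        (forall x y z, x <> z ->
          gd.2 x y <= approximation_distortion H n (e x y / e x z) * gd.2 x z)].
  have k0 : 0 < k.+1%:R^-1 :> R by rewrite invr_gt0.
  have [c [rho [s [c0 s0 rm loc [close ratio]]]]] :=
    approximating_metric Hiso n2 H2 H2n H1n em dm qs middle eD dD p01 k0.
  have [g' g'E] := intrinsic_metric_scaling g c0.
  by exists (g', rho), c, s.
have [gd gdP] := choice approx.
exists (fun k => (gd k).1), (fun k => (gd k).2); split=> [k|k||k].
- by have [c [s []]] := gdP k.
- have [c [s [[c0 g'E] s0 _ loc _]]] := gdP k.
  exact: locally_isometric_scaled em c0 s0 g'E loc.
- apply: gromov_hausdorff_cvg0 => k.
  have [c [s [_ _ rm _ [close _]]]] := gdP k.
  apply: (@gromov_hausdorff_distance_le _ X X _ _ f h p0 (Dd + k.+1%:R^-1) Dd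
    k.+1%:R^-1 _ rm mX hK _ _ close).
  + move=> x y; have := close x y; have := dD x y; rewrite ler_norml.
    by move=> dxy /andP[_]; rewrite lerBlDl => /le_trans; apply; rewrite lerD2r.
  + exact: dD0.
  + by rewrite ltr_pMl ?ltr1n// invr_gt0.
- have [c [s [[c0 g'E] s0 rm loc [_ ratio]]]] := gdP k.
  exists id; split; first exact: dhomeomorphism_id c0 s0 loc.
  move=> x y z xy xz yz.
  have exz : 0 < e x z by exact: is_metric_gt0.
  have exy : 0 < e x y by exact: is_metric_gt0.
  have rxz : 0 < (gd k).2 x z by exact: is_metric_gt0.
  have rxy : 0 < (gd k).2 x y by exact: is_metric_gt0.
  apply: (halfline_iso_ratio_inv i0) => //.
  by rewrite ler_pdivrMr//; exact: ratio.
Qed.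

End quasisymmetric_implies_approximation.

(** * Limits of quasisymmetries *)

Section gromov_hausdorff_approximation.
Context {R : realType} {X : Type} (d1 d2 : X -> X -> R).

(** Almost surjectivity is given by a map [psi], so that the sequence of its values at a point can
    be followed to a limit. *)
Definition gh_approximation (r : R) (phi psi : X -> X) : Prop :=
  (forall x y, `|d1 x y - d2 (phi x) (phi y)| < r) /\
  (forall w, d2 (phi (psi w)) w < r).

Lemma gromov_hausdorff_approximation (r : R) :
  (gromov_hausdorff_distance d1 d2 < r%:E)%E -> exists phi psi,
  gh_approximation (2 * r) phi psi.
Proof.
move=> /ereal_inf_lt[_ [Z [dZ [i [j [mZ iE jE ->]]]]]].
move=> /ereal_inf_lt[_ [s [s0 ij ji] <-]]; rewrite lte_fin => sr.
have near_pt x : exists y, dZ (i x) (j y) < s.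
  by have [_ [y _ <-] h] := ij (i x) (ex_intro2 _ _ x I erefl); exists y.
have near_pt' y : exists x, dZ (j y) (i x) < s.
  by have [_ [x _ <-] h] := ji (j y) (ex_intro2 _ _ y I erefl); exists x.
have [phi phiP] := choice near_pt; have [psi psiP] := choice near_pt'.
exists phi, psi; split=> [x y|w].
  rewrite -iE -jE.
  have := is_metric_triangle mZ (i x) (j (phi x)) (i y).
  have := is_metric_triangle mZ (j (phi x)) (j (phi y)) (i y).
  have := is_metric_triangle mZ (j (phi x)) (i x) (j (phi y)).
  have := is_metric_triangle mZ (i x) (i y) (j (phi y)).
  rewrite (is_metric_sym mZ (j (phi x)) (i x)) (is_metric_sym mZ (j (phi y)) (i y)).
  by have := phiP x; have := phiP y; rewrite ltr_norml => *; apply/andP; split; lra.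
set x := psi w; rewrite -jE; have := is_metric_triangle mZ (j (phi x)) (i x) (j w).
rewrite (is_metric_sym mZ (j (phi x)) (i x)) (is_metric_sym mZ (i x) (j w)).
by have := phiP x; have := psiP w; rewrite -/x; lra.
Qed.

End gromov_hausdorff_approximation.

Lemma gh_approximation_seq (R : realType) (X : Type) (dk : nat -> X -> X -> R)
    (d : X -> X -> R) :
  gromov_hausdorff_distance (dk k) d @[k --> \oo] --> 0%E ->
  exists phi psi : nat -> X -> X, forall r, 0 < r ->
    \forall k \near \oo, gh_approximation (dk k) d r (phi k) (psi k).
Proof.
move=> gh.
pose r k := fine (gromov_hausdorff_distance (dk k) d) + k.+1%:R^-1.
have ex k : exists fg : (X -> X) * (X -> X),
    (gromov_hausdorff_distance (dk k) d < (r k)%:E)%E ->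
    gh_approximation (dk k) d (2 * r k) fg.1 fg.2.
  have [h|h] := pselect (gromov_hausdorff_distance (dk k) d < (r k)%:E)%E.
    by have [phi [psi ?]] := gromov_hausdorff_approximation h; exists (phi, psi).
  (* Arbitrary maps where the distance is infinite and [r k] is a junk bound; by convergence this
     concerns finitely many [k]. *)
  by exists (id, id).
have [fg fgP] := choice ex; exists (fun k => (fg k).1), (fun k => (fg k).2) => s s0.
have s4 : 0 < s / 4 by rewrite divr_gt0.
have near1 : \forall k \near \oo, (gromov_hausdorff_distance (dk k) d < (s / 4)%:E)%E.
  have nb : nbhs 0%E [set x | (x < (s / 4)%:E)%E].
    by apply: open_nbhs_nbhs; split; [exact: open_ereal_lt_ereal|rewrite /= lte_fin].
  exact: gh nb.
have near2 : \forall k \near \oo, k.+1%:R^-1 < s / 4.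
  by have /cvgr_lt := @cvg_harmonic R; apply.
apply: filterS2 near1 near2 => k h1 h2.
have ge0 := gromov_hausdorff_distance_ge0 (dk k) d.
have fin : gromov_hausdorff_distance (dk k) d \is a fin_num.
  by rewrite ge0_fin_numE// (lt_trans h1)// ltry.
have h1' : fine (gromov_hausdorff_distance (dk k) d) < s / 4.
  by rewrite -lte_fin fineK.
have [|a b] := fgP k.
  by rewrite -[ltLHS]fineK// lte_fin /r ltrDl invr_gt0.
have rs : 2 * r k < s.
  apply: (@lt_le_trans _ _ (2 * (s / 4 + s / 4))); last lra.
  by rewrite ltr_pM2l// ltrD.
split=> [x y|w]; first exact: lt_trans (a x y) rs.
exact: lt_trans (b w) rs.
Qed.

Section limit_quasisymmetry.
Context {R : realType} {X : Type} (eta theta : R -> R).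
Variables (e dX : X -> X -> R) (dk : nat -> X -> X -> R) (phi psi : nat -> X -> X).
Hypotheses (et : halfline_iso eta theta) (em : is_metric e) (dm : is_metric dX).
Hypotheses (dkm : forall k, is_metric (dk k)).
Hypotheses (ec : ultra_compact e) (dc : ultra_compact dX).
Variables (D : R) (p0 p1 : X).
Hypotheses (dD : forall x y, dX x y <= D) (p01 : p0 <> p1).
Hypothesis qs : forall k x y z, x <> y -> x <> z -> y <> z ->
  e x y / e x z <= eta (dk k x y / dk k x z).
Hypothesis approx : forall r, 0 < r ->
  \forall k \near \oo, gh_approximation (dk k) dX r (phi k) (psi k).
Variable U : set_system nat.
Hypotheses (UU : UltraFilter U) (Uoo : \oo `<=` U).

Local Notation eta' := (fun t => (theta t^-1)^-1).
Let PU : ProperFilter U. Proof. exact: ultra_proper. Qed.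
Let i' : halfline_iso eta' (fun t => (eta t^-1)^-1).
Proof. exact: halfline_iso_inv et. Qed.

Let U_mem (A : set nat) : U A -> exists k, A k.
Proof. by move=> UA; have [k Ak] := filter_ex UA; exists k. Qed.

Let UI (A B : set nat) : U A -> U B -> U (A `&` B).
Proof. exact: filterI. Qed.

Let qs' k x y z : x <> y -> x <> z -> y <> z ->
  dk k x y <= eta' (e x y / e x z) * dk k x z.
Proof.
move=> xy xz yz.
have h := qs k xz xy (nesym yz).
have kxy : 0 < dk k x y by apply: is_metric_gt0.
have kxz : 0 < dk k x z by apply: is_metric_gt0.
rewrite -ler_pdivrMr//.
by apply: (halfline_iso_ratio_inv et) => //; exact: is_metric_gt0.
Qed.

Let Uapprox r : 0 < r -> U [set k | gh_approximation (dk k) dX r (phi k) (psi k)].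
Proof. by move=> r0; apply: Uoo; exact: approx. Qed.

Let dk_bounded : U [set k | forall x y, dk k x y <= D + 1].
Proof.
apply: filterS (Uapprox ltr01) => k [h _] x y.
by have := h x y; have := dD (phi k x) (phi k y); rewrite ltr_norml => ? /andP[]; lra.
Qed.

Let D_ge0 : 0 <= D.
Proof. by apply: le_trans (dD p0 p0); exact: is_metric_ge0. Qed.

(** One of [p0], [p1] is at distance at least [r1] from [x]; compared with it, [y] is relatively
    close, and [dk] is at most [D + 1] for almost all [k]. *)
Let equicontinuous r : 0 < r -> exists2 tau, 0 < tau &
  U [set k | forall x y, e x y < tau -> dk k x y < r].
Proof.
move=> r0; have D1 : 0 < D + 1 by have := D_ge0; lra.
have rD : 0 < r / (D + 1) by rewrite divr_gt0.
have [s s0 sP] := halfline_iso_small i' rD.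
pose r1 := e p0 p1 / 2.
have r10 : 0 < r1 by rewrite divr_gt0// is_metric_gt0.
exists (Num.min r1 (s * r1)); first by rewrite lt_min r10 mulr_gt0.
apply: filterS dk_bounded => k kD x y; rewrite lt_min => /andP[exy1 exys].
have [xy|xy] := pselect (x = y); first by rewrite xy (is_metric_refl (dkm k)).
have [z xz] : exists z, r1 <= e x z.
  have := is_metric_triangle em p0 x p1; rewrite (is_metric_sym em p0 x).
  have [h _|h t] := leP r1 (e x p0); first by exists p0.
  by exists p1; rewrite /r1 in h *; lra.
have exz : 0 < e x z by exact: lt_le_trans r10 xz.
have xz' : x <> z by move=> E; rewrite E (is_metric_refl em) ltxx in exz.
have yz : y <> z by move=> E; rewrite E ltNge xz in exy1.
apply: le_lt_trans (qs' k xy xz' yz) _.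
have t0 : 0 <= e x y / e x z by rewrite divr_ge0 ?is_metric_ge0.
have small : eta' (e x y / e x z) < r / (D + 1).
  apply: sP => //; rewrite ltr_pdivrMr//; apply: lt_le_trans exys _.
  by rewrite ler_pM2l.
have eta'0 : 0 <= eta' (e x y / e x z) by have [+ _ _ _ _] := i'; apply.
apply: le_lt_trans (ler_wpM2l eta'0 (kD x z)) _.
by rewrite -ltr_pdivlMr.
Qed.

Let limit_exists : exists F : X -> X, forall x r, 0 < r ->
  U [set k | dX (F x) (phi k x) < r].
Proof.
have ex x : exists w, forall r, 0 < r -> U [set k | dX w (phi k x) < r].
  exact: (dc UU (fun k => phi k x)).
by have [F FP] := choice ex; exists F.
Qed.

Section limit_map.
Variable F : X -> X.
Hypothesis FP : forall x r, 0 < r -> U [set k | dX (F x) (phi k x) < r].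

Let F_dist x y r : 0 < r -> U [set k | `|dk k x y - dX (F x) (F y)| < r].
Proof.
move=> r0; have r3 : 0 < r / 3 by rewrite divr_gt0.
apply: filterS3 (FP x r3) (FP y r3) (Uapprox r3) => k /= Fx Fy [+ _].
move=> /(_ x y); have := is_metric_triangle dm (F x) (phi k x) (F y).
have := is_metric_triangle dm (phi k x) (phi k y) (F y).
have := is_metric_triangle dm (phi k x) (F x) (phi k y).
have := is_metric_triangle dm (F x) (F y) (phi k y).
rewrite (is_metric_sym dm (phi k y) (F y)) (is_metric_sym dm (phi k x) (F x)).
by rewrite !ltr_norml => ? ? ? ? /andP[? ?]; apply/andP; split; lra.
Qed.

Let F_continuous r : 0 < r -> exists2 tau, 0 < tau &
  forall x y, e x y < tau -> dX (F x) (F y) < r.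
Proof.
move=> r0; have r2 : 0 < r / 2 by rewrite divr_gt0.
have [tau tau0 tauP] := equicontinuous r2; exists tau => // x y exy.
have [k [h1 h2]] := U_mem (UI tauP (F_dist x y r2)).
by move: h2 (h1 x y exy) => /=; rewrite ltr_norml => /andP[]; lra.
Qed.

(** Otherwise there are bad pairs for almost all [k]. They converge along [U] by compactness of [e];
    equicontinuity of [dk] and continuity of [F] carry the failure to the limit pair, against
    pointwise convergence there. *)
Let F_uniform r : 0 < r ->
  U [set k | forall x y, `|dk k x y - dX (F x) (F y)| < r].
Proof.
move=> r0; have r8 : 0 < r / 8 by rewrite divr_gt0.
have [//|bad] := in_ultra_setVsetC
  [set k | forall x y, `|dk k x y - dX (F x) (F y)| < r] UU.
have ex k : exists xy : X * X,
    (exists x y, r <= `|dk k x y - dX (F x) (F y)|) ->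
    r <= `|dk k xy.1 xy.2 - dX (F xy.1) (F xy.2)|.
  have [[x [y h]]|h] := pselect (exists x y, r <= `|dk k x y - dX (F x) (F y)|).
    by exists (x, y).
  by exists (p0, p0).
have [u uP] := choice ex.
have [x xP] := ec UU (fun k => (u k).1).
have [y yP] := ec UU (fun k => (u k).2).
have [t1 t10 t1P] := equicontinuous r8.
have [t2 t20 t2P] := F_continuous r8.
have t0 : 0 < Num.min t1 t2 by rewrite lt_min t10.
have H := UI (UI (xP _ t0) (yP _ t0)) (UI t1P (F_dist x y r8)).
have [k [badk [[xk yk] [eqk Fk]]]] := U_mem (UI bad H).
have badu : r <= `|dk k (u k).1 (u k).2 - dX (F (u k).1) (F (u k).2)|.
  apply: uP; apply: contrapT => no; apply: badk => v w.
  by rewrite ltNge; apply/negP => h; apply: no; exists v, w.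
move: xk yk Fk badu; rewrite /= !lt_min => /andP[x1 x2] /andP[y1 y2].
set v := (u k).1; set w := (u k).2; rewrite -/v -/w in x1 x2 y1 y2.
have := eqk _ _ x1; have := eqk _ _ y1; have := t2P _ _ x2; have := t2P _ _ y2.
have := is_metric_triangle (dkm k) v x w; have := is_metric_triangle (dkm k) x y w.
have := is_metric_triangle (dkm k) x v y; have := is_metric_triangle (dkm k) v w y.
have := is_metric_triangle dm (F v) (F x) (F w).
have := is_metric_triangle dm (F x) (F y) (F w).
have := is_metric_triangle dm (F x) (F v) (F y).
have := is_metric_triangle dm (F v) (F w) (F y).
rewrite (is_metric_sym (dkm k) v x) (is_metric_sym (dkm k) w y).
rewrite (is_metric_sym dm (F v) (F x)) (is_metric_sym dm (F w) (F y)).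
move=> a1 a2 a3 a4 a5 a6 a7 a8 b1 b2 b3 b4.
rewrite ltr_norml => /andP[c1 c2].
suff : `|dk k v w - dX (F v) (F w)| < r by move=> h; rewrite leNgt h.
by rewrite ltr_norml; apply/andP; split; lra.
Qed.

Let F_qs x y z : x <> y -> x <> z -> y <> z ->
  dX (F x) (F y) <= eta' (e x y / e x z) * dX (F x) (F z).
Proof.
move=> xy xz yz /=; set s := (theta (e x y / e x z)^-1)^-1.
have s0 : 0 <= s.
  by have [+ _ _ _ _] := i'; apply; rewrite divr_ge0 ?is_metric_ge0.
apply/ler_addgt0Pl => r r0.
(* An error of this size enters once on the left and [s] times on the right, in total [r]. *)
have r1 : 0 < r / (1 + s) by rewrite divr_gt0//; lra.
have [k [/= h1 h2]] := U_mem (UI (F_dist x y r1) (F_dist x z r1)).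
have hk : dk k x y <= s * dk k x z := qs' k xy xz yz.
move: h1 h2; rewrite !ltr_norml => /andP[h1 h1'] /andP[h2 h2'].
have h3 : dk k x z <= dX (F x) (F z) + r / (1 + s) by lra.
have := ler_wpM2l s0 h3; rewrite mulrDr => h4.
have s1 : 1 + s != 0 by rewrite gt_eqF//; lra.
have E : r / (1 + s) + s * (r / (1 + s)) = r.
  by rewrite -{1}[r / (1 + s)]mul1r -mulrDl mulrC divfK.
move: (r / (1 + s)) r1 h1 h1' h2 h2' h3 h4 E => q *; lra.
Qed.

(** A preimage of [w] is the limit of the approximate preimages [psi k w]. *)
Let F_surj w : exists v, F v = w.
Proof.
have [v vP] := ec UU (fun k => psi k w); exists v.
apply: (is_metric_le0 dm) => r r0; have r4 : 0 < r / 4 by rewrite divr_gt0.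
have [tau tau0 tauP] := equicontinuous r4.
have H := UI (UI (vP _ tau0) tauP) (UI (FP v r4) (Uapprox r4)).
have [k [[/= vk eqk] [/= Fk [ak bk]]]] := U_mem H.
have := eqk _ _ vk; have := ak v (psi k w); have := bk w.
have := is_metric_triangle dm (F v) (phi k v) w.
have := is_metric_triangle dm (phi k v) (phi k (psi k w)) w.
by rewrite ltr_norml => ? ? ? /andP[? ?] ?; lra.
Qed.

(** If [F] identifies two points, the distortion bound collapses every other point onto them; a
    constant map cannot be onto a space containing [p0] and [p1]. *)
Let F_inj : injective F.
Proof.
move=> x z Fxz; have [//|xz] := pselect (x = z).
have Fx y : F y = F x.
  have [->//|yx] := pselect (y = x).
  have [->//|yz] := pselect (y = z).
  apply/esym/(is_metric_eq0 dm)/eqP; rewrite eq_le is_metric_ge0// andbT.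
  by have := F_qs (nesym yx) xz yz; rewrite -Fxz (is_metric_refl dm) mulr0.
have [q0 E0] := F_surj p0; have [q1 E1] := F_surj p1.
by case: p01; rewrite -E0 -E1 (Fx q0) (Fx q1).
Qed.

(** A sequence whose images tend to [F x] while it stays [r] away from [x] has a limit [y] along [U]
    with [F y = F x], and injectivity gives the contradiction. *)
Let F_inv_continuous x r : 0 < r -> exists2 s, 0 < s &
  forall y, dX (F x) (F y) < s -> e x y < r.
Proof.
move=> r0; apply: contrapT => H.
have ex (k : nat) : exists y, dX (F x) (F y) < k.+1%:R^-1 /\ r <= e x y.
  apply: contrapT => no; apply: H; exists k.+1%:R^-1; first by rewrite invr_gt0.
  by move=> y h; rewrite ltNge; apply/negP => h'; apply: no; exists y.
have [u uP] := choice ex; have [y yP] := ec UU u.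
have Fxy : F x = F y.
  apply: (is_metric_le0 dm) => s s0; have s2 : 0 < s / 2 by rewrite divr_gt0.
  have [tau tau0 tauP] := F_continuous s2.
  have near2 : \forall k \near \oo, k.+1%:R^-1 < s / 2.
    by have /cvgr_lt := @cvg_harmonic R; apply.
  have [k [/= yk h2]] := U_mem (UI (yP _ tau0) (Uoo near2)).
  have [h _] := uP k; have := lt_trans h h2; have := tauP _ _ yk.
  have := is_metric_triangle dm (F x) (F (u k)) (F y).
  by rewrite (is_metric_sym dm (F (u k))); lra.
have [k /= yk] := U_mem (yP _ r0).
by have [_] := uP k; rewrite (F_inj Fxy) leNgt yk.
Qed.

Lemma limit_map_quasisymmetry :
  quasisymmetry eta' e dX F /\
  forall r, 0 < r -> U [set k | forall x y, `|dk k x y - dX (F x) (F y)| < r].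
Proof.
split; last exact: F_uniform.
have [G GP] := choice F_surj.
have GK : cancel F G by move=> x; apply: F_inj; rewrite GP.
split.
  exists G; split=> // x r r0.
    have [tau tau0 tauP] := F_continuous r0; exists tau => // _ [y /= yx <-].
    exact: tauP.
  have [s s0 sP] := F_inv_continuous (G x) r0; exists s => // _ [y /= yx <-].
  by apply: sP; rewrite !GP.
move=> x y z xy xz yz; rewrite ler_pdivrMr; first exact: F_qs.
by apply: is_metric_gt0 => // /F_inj.
Qed.

End limit_map.

Lemma limit_quasisymmetry : exists F, quasisymmetry eta' e dX F /\
  forall r, 0 < r -> U [set k | forall x y, `|dk k x y - dX (F x) (F y)| < r].
Proof.
by have [F FP] := limit_exists; exists F; exact: limit_map_quasisymmetry.
Qed.

End limit_quasisymmetry.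

Section composition.
Context {R : realType} {X Y Z : Type}.
Variables (dX : X -> X -> R) (dY : Y -> Y -> R) (dZ : Z -> Z -> R).

Lemma dcontinuous_comp (f : X -> Y) (h : Y -> Z) :
  dcontinuous dX dY f -> dcontinuous dY dZ h -> dcontinuous dX dZ (h \o f).
Proof.
move=> fc hc x r r0; have [s s0 hs] := hc (f x) r r0.
have [t t0 ft] := fc x s s0; exists t => // _ [y xy <-].
by apply: hs; exists (f y) => //; apply: ft; exists y.
Qed.

Lemma quasisymmetry_comp (eta theta eta' : R -> R) (theta' : R -> R) (f : X -> Y)
    (h : Y -> Z) : halfline_iso eta theta -> halfline_iso eta' theta' ->
  is_metric dX -> is_metric dY ->
  quasisymmetry eta dX dY f -> quasisymmetry eta' dY dZ h ->
  quasisymmetry (eta' \o eta) dX dZ (h \o f).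
Proof.
move=> et et' mX mY [[fi [fK fiK fc fic]] fqs] [[hi [hK hiK hc hic]] hqs].
split.
  exists (fi \o hi); split.
  - exact: can_comp.
  - exact: can_comp.
  - exact: dcontinuous_comp fc hc.
  - move=> x r r0; have [s s0 fs] := fic (hi x) r r0.
    have [t t0 ht] := hic x s s0; exists t => // _ [y xy <-].
    by apply: fs; exists (hi y) => //; apply: ht; exists y.
move=> x y z xy xz yz; have finj := can_inj fK.
have fxy : f x <> f y by move=> /finj.
have fxz : f x <> f z by move=> /finj.
have fyz : f y <> f z by move=> /finj.
apply: le_trans (hqs _ _ _ fxy fxz fyz) _.
have [eta0 _ _ _ _] := et.
rewrite (halfline_iso_le et'); [exact: fqs| |].
- by rewrite divr_ge0 ?is_metric_ge0.
- by apply: eta0; rewrite divr_ge0 ?is_metric_ge0.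
Qed.

End composition.

(** * From approximating metrics to quasisymmetries *)

Section approximation_limits.
Context {R : realType} {X : topologicalType} {M : smooth_surface (R := R) X}.
Variables (g : riemannian_metric M) (dX : X -> X -> R) (eta theta : R -> R).
Variables (gs : nat -> riemannian_metric M) (ds : nat -> X -> X -> R).
Hypotheses (Xc : compact [set: X]) (dm : is_metric dX).
Hypotheses (dt : induces_topology dX) (et : halfline_iso eta theta).
Hypothesis ua : uniform_approximation g dX eta gs ds.
Local Notation e := (intrinsic_metric g).
Local Notation eta' := (fun t => (theta t^-1)^-1).

Let dsm k : is_metric (ds k). Proof. by have [] := ua. Qed.

Let separates x y : e x y = 0 -> x = y.
Proof.
have [_ _ _ /(_ 0%N)[h [[hi [hK hiK hc hic]] _]]] := ua.
by move=> exy; rewrite -(hiK x) (dcontinuous_eq0 (dsm 0%N) hic exy) hiK.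
Qed.

Lemma approximated_intrinsic_is_metric : is_metric e.
Proof. exact: intrinsic_is_metric. Qed.
Let em := approximated_intrinsic_is_metric.

Let e_nbhs x r : 0 < r -> nbhs x (dball e x r).
Proof. exact: intrinsic_metric_nbhs. Qed.

Variables p0 p1 : X.
Hypothesis p01 : p0 <> p1.

(** The maps [h] are fixed before the ultrafilter, so that limits along different ultrafilters can
    be compared. The bounds on [ds k] are for every [k], not only for almost all. *)
Lemma approximation_limits : exists h : nat -> X -> X,
  [/\ forall k, quasisymmetry eta (ds k) e (h k),
    forall k, exists B, forall x y, ds k x y <= B &
    forall U, UltraFilter U -> \oo `<=` U -> exists F, quasisymmetry eta' e dX F /\
      forall r, 0 < r ->
        U [set k | forall x y, `|ds k x y - dX (F (h k x)) (F (h k y))| < r]].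
Proof.
have [_ _ gh /choice[h hP]] := ua.
have /choice[hi hiP] : forall k, exists hi,
    cancel (h k) hi /\ cancel hi (h k).
  by move=> k; have [[hi [? ? _ _]] _] := hP k; exists hi.
have hK k : cancel (h k) (hi k) by have [] := hiP k.
have hiK k : cancel (hi k) (h k) by have [] := hiP k.
have [phi [psi approx]] := gh_approximation_seq gh.
pose dk k x y := ds k (hi k x) (hi k y).
have dkm k : is_metric (dk k) by exact: induced_metric (can_inj (hiK k)) (dsm k).
have approx' r : 0 < r -> \forall k \near \oo,
    gh_approximation (dk k) dX r (phi k \o hi k) (h k \o psi k).
  move=> /approx; apply: filterS => k [a b]; split=> [x y|w]; first exact: a.
  by rewrite /= hK.
have qs k x y z : x <> y -> x <> z -> y <> z ->
    e x y / e x z <= eta (dk k x y / dk k x z).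
  move=> xy xz yz; have [_ hqs] := hP k.
  have inj := can_inj (hiK k).
  have := hqs (hi k x) (hi k y) (hi k z); rewrite !hiK; apply.
  - by move=> /inj.
  - by move=> /inj.
  - by move=> /inj.
have ec := compact_ultra_compact Xc e_nbhs.
have d_nbhs x r : 0 < r -> nbhs x (dball dX x r) by exact: induces_topology_nbhs.
have dc := compact_ultra_compact Xc d_nbhs.
have [D dD] := metric_bounded dm Xc d_nbhs.
have [E eE] := metric_bounded em Xc e_nbhs.
exists h; split=> [//|k|U UU Uoo].
  have i' := halfline_iso_inv et.
  have e01 : 0 < e p0 p1 by exact: is_metric_gt0.
  have k01 : 0 < dk k p0 p1 by exact: is_metric_gt0.
  have E0 : 0 <= E by apply: le_trans (eE p0 p1); exact: ltW.
  (* Quasisymmetry around [p0] compares [x] with [p1]; the second summand takes care of [x = p1],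
     where distinctness of the three points fails. *)
  pose C := eta' (E / e p0 p1) * dk k p0 p1 + dk k p0 p1.
  have eta'0 : 0 <= eta' (E / e p0 p1).
    by have [+ _ _ _ _] := i'; apply; rewrite divr_ge0 ?(ltW e01).
  have bound x : dk k p0 x <= C.
    have [->|p0x] := pselect (x = p0).
      by rewrite is_metric_refl// addr_ge0 ?mulr_ge0// ltW.
    have [->|p1x] := pselect (x = p1); first by rewrite lerDr mulr_ge0// ltW.
    have := halfline_iso_ratio_inv et k01 (is_metric_gt0 (dkm k) (nesym p0x))
      e01 (is_metric_gt0 em (nesym p0x)) (qs k p0 p1 x p01 (nesym p0x) (nesym p1x)).
    rewrite ler_pdivrMr// => /le_trans; apply.
    apply: le_trans (_ : eta' (E / e p0 p1) * dk k p0 p1 <= _).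
      rewrite ler_wpM2r ?(ltW k01)//.
      rewrite (halfline_iso_le i') ?divr_ge0 ?is_metric_ge0//.
      by rewrite ler_wpM2r ?invr_ge0 ?(ltW e01).
    by rewrite lerDl ltW.
  exists (C + C) => x y.
  rewrite -(hK k x) -(hK k y) -/(dk k (h k x) (h k y)).
  apply: le_trans (is_metric_triangle (dkm k) _ p0 _) _.
  by rewrite (is_metric_sym (dkm k) _ p0) lerD.
have [F [Fqs Fclose]] :=
  limit_quasisymmetry et em dm dkm ec dc dD p01 qs approx' UU Uoo.
exists F; split=> // r r0; have PU := ultra_proper.
apply: filterS (Fclose r r0) => k /= H x y.
by have := H (h k x) (h k y); rewrite /dk !hK.
Qed.

End approximation_limits.

(** If [P] is not eventually true, its complement and the cofinite sets lie in a common ultrafilter,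
    which would contain [P] and its complement. *)
Lemma near_oo_ultra (P : set nat) :
  (forall U : set_system nat, UltraFilter U -> \oo `<=` U -> U P) ->
  \forall k \near \oo, P k.
Proof.
move=> H; apply: contrapT => nP.
have PF : ProperFilter (within (~` P) \oo).
  apply: Build_ProperFilter => w0; apply: nP.
  have {}w0 : \forall k \near \oo, ~ P k -> False by exact: w0.
  by apply: filterS w0 => k h; apply: contrapT => /h.
have [U [UU sU]] := ultraFilterLemma PF.
have PU := ultra_proper.
have Uoo : \oo `<=` U.
  move=> A nA; apply: sU.
  have nA' : \forall k \near \oo, ~ P k -> A k by apply: filterS nA.
  exact: nA'.
have UnP : U (~` P).
  have nP' : \forall k \near \oo, ~ P k -> ~ P k by exact: nearW.
  by apply: sU; exact: nP'.
by have [k [Pk nPk]] := filter_ex (filterI (H U UU Uoo) UnP).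
Qed.

Section conclusions.
Context {R : realType}.

Theorem approximation_implies_quasisymmetric (eta : R -> R) :
  distortion_function eta ->
  exists2 eta' : R -> R, distortion_function eta' &
    forall (X : topologicalType) (M : smooth_surface X)
      (g : riemannian_metric M) (dX : X -> X -> R),
      compact [set: X] -> connected [set: X] ->
      is_metric dX -> induces_topology dX ->
      (exists (gs : nat -> riemannian_metric M) (ds : nat -> X -> X -> R),
        uniform_approximation g dX eta gs ds) ->
      quasisymmetric_to eta' (intrinsic_metric g) dX.
Proof.
move=> /distortion_functionP[theta et].
exists (fun t => (theta t^-1)^-1).
  by apply/distortion_functionP; eexists; exact: halfline_iso_inv et.
move=> X M g dX Xc Xn dm dt [gs [ds ua]].
have em := approximated_intrinsic_is_metric ua.
have [[p0 [p1 p01]]|trivial] := pselect (exists p0 p1 : X, p0 <> p1).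
  have [h [_ _ lim]] := approximation_limits Xc dm dt et ua p01.
  have [U [UU Uoo]] := @ultraFilterLemma nat \oo _.
  by have [F [Fqs _]] := lim U UU Uoo; exists F.
have all_eq (x y : X) : x = y.
  by have [//|xy] := pselect (x = y); case: trivial; exists x, y.
exists id; split; last by move=> x y z xy; case: xy; exact: all_eq.
exists id; split=> // x r r0; exists r => // _ [y yr <-] /=;
  by rewrite /dball /= (all_eq x y) is_metric_refl.
Qed.

Theorem approximation_by_quasisymmetries (X : topologicalType)
    (M : smooth_surface X) (g : riemannian_metric M) (dX : X -> X -> R)
    (eta : R -> R) (gs : nat -> riemannian_metric M) (ds : nat -> X -> X -> R) :
  compact [set: X] -> is_metric dX -> induces_topology dX ->
  distortion_function eta -> uniform_approximation g dX eta gs ds ->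
  exists (eta' : R -> R) (f : nat -> X -> X),
    [/\ distortion_function eta', approximately_isometric ds dX f
      & forall k, quasisymmetry eta' (ds k) dX (f k)].
Proof.
move=> Xc dm dt /distortion_functionP[theta et] ua.
have em := approximated_intrinsic_is_metric ua.
have dsm k : is_metric (ds k) by have [] := ua.
have i' := halfline_iso_inv et.
pose eta' t := (theta t^-1)^-1.
exists (eta' \o eta).
have dist : distortion_function (eta' \o eta).
  by apply/distortion_functionP; eexists; exact: halfline_iso_comp i' et.
have [[p0 [p1 p01]]|trivial] := pselect (exists p0 p1 : X, p0 <> p1); last first.
  have all_eq (x y : X) : x = y.
    by have [//|xy] := pselect (x = y); case: trivial; exists x, y.
  exists (fun=> id); split=> // [|k].
    exists (fun k => k.+1%:R^-1); split=> [k||k]; first by rewrite invr_gt0.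
      exact: cvg_harmonic.
    split=> [z|x y].
      by exists z; rewrite is_metric_refl// invr_gt0.
    by rewrite (all_eq x y) !is_metric_refl// subrr normr0 invr_gt0.
  split; last by move=> x y z xy; case: xy; exact: all_eq.
  exists id; split=> // x r r0; exists r => // _ [y yr <-] /=;
    by rewrite /dball /= (all_eq x y) is_metric_refl.
have [h [hqs hB lim]] := approximation_limits Xc dm dt et ua p01.
have [D dD] := metric_bounded dm Xc (fun x r => @induces_topology_nbhs R X dX x r dt).
pose good k r F := quasisymmetry eta' (intrinsic_metric g) dX F /\
  forall x y, `|ds k x y - dX (F (h k x)) (F (h k y))| < r.
have near_good r : 0 < r -> \forall k \near \oo, exists F, good k r F.
  move=> r0; apply: near_oo_ultra => U UU Uoo; have PU := ultra_proper.
  have [F [Fqs Fclose]] := lim U UU Uoo.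
  by apply: filterS (Fclose r r0) => k /= Fk; exists F.
(* A crude radius from the bounds on both metrics. It makes the set of good radii nonempty for every
   [k], so that its infimum is a true one. *)
have some_good k : exists r, 0 < r /\ exists F, good k r F.
  have [U [UU Uoo]] := @ultraFilterLemma nat \oo _.
  have [F [Fqs _]] := lim U UU Uoo; have [B bB] := hB k.
  exists (`|B| + `|D| + 1); split; first by rewrite ltr_wpDl// addr_ge0.
  exists F; split=> // x y; apply: le_lt_trans (ler_normB _ _) _.
  rewrite (ger0_norm (is_metric_ge0 (dsm k) _ _)) (ger0_norm (is_metric_ge0 dm _ _)).
  have := le_trans (bB x y) (ler_norm B).
  have := le_trans (dD (F (h k x)) (F (h k y))) (ler_norm D); lra.
(* The choice of [F] is optimal up to [1 / (k + 1)] among the quasisymmetries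
   with a fixed distortion. *)
pose good_radii k := [set r | 0 < r /\ exists F, good k r F].
pose r k := inf (good_radii k) + k.+1%:R^-1.
have lb k : lbound (good_radii k) 0 by move=> s [/ltW].
have rP k : exists F, good k (r k) F.
  have ik : 0 < k.+1%:R^-1 :> R by rewrite invr_gt0.
  have hi : has_inf (good_radii k).
    by split; [exact: some_good|exists 0; exact: lb].
  have [s [s0 [F [Fqs Fs]]] sr] := inf_adherent ik hi.
  by exists F; split=> // x y; exact: lt_trans (Fs x y) sr.
have r0 k : 0 < r k.
  rewrite ltr_wpDl ?invr_gt0//; apply: lb_le_inf; last exact: lb.
  exact: some_good.
have [F FP] := choice rP.
(* All the [h k] have distortion [eta] and all the [F k] distortion [eta'], whatever the
   ultrafilters behind them; this is what makes the composites uniform. *)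
exists (fun k => F k \o h k); split=> // [|k]; last first.
  have [Fqs _] := FP k.
  exact: quasisymmetry_comp et i' (dsm k) em (hqs k) Fqs.
exists r; split=> [//||k].
  apply/cvgrPdist_lt => s s0; have s2 : 0 < s / 2 by rewrite divr_gt0.
  have near2 : \forall k \near \oo, k.+1%:R^-1 < s / 2.
    by have /cvgr_lt := @cvg_harmonic R; apply.
  apply: filterS2 (near_good _ s2) near2 => k gk k2.
  rewrite sub0r normrN gtr0_norm//.
  have le : inf (good_radii k) <= s / 2.
    by apply: ge_inf; [exists 0; exact: lb|split].
  by rewrite (splitr s); exact: ler_ltD.
have [[[Fi [FK FiK _ _]] _] Fclose] := FP k.
split=> [z|//].
have [[hi [_ hiK _ _]] _] := hqs k.
by exists (hi (Fi z)); rewrite /= hiK FiK is_metric_refl.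
Qed.

End conclusions.

Theorem theorem1p8 (R : realType) :
  [/\
      forall eta : R -> R, distortion_function eta ->
      exists2 eta' : R -> R, distortion_function eta' &
        forall (X : topologicalType) (M : smooth_surface X)
          (g : riemannian_metric M) (dX : X -> X -> R),
          compact [set: X] -> connected [set: X] ->
          is_metric dX -> induces_topology dX ->
          quasisymmetric_to eta (intrinsic_metric g) dX ->
          exists (gs : nat -> riemannian_metric M) (ds : nat -> X -> X -> R),
            uniform_approximation g dX eta' gs ds,
      forall eta : R -> R, distortion_function eta ->
      exists2 eta' : R -> R, distortion_function eta' &
        forall (X : topologicalType) (M : smooth_surface X)
          (g : riemannian_metric M) (dX : X -> X -> R),
          compact [set: X] -> connected [set: X] ->
          is_metric dX -> induces_topology dX ->
          (exists (gs : nat -> riemannian_metric M) (ds : nat -> X -> X -> R),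
            uniform_approximation g dX eta gs ds) ->
          quasisymmetric_to eta' (intrinsic_metric g) dX
    &
      forall (X : topologicalType) (M : smooth_surface X)
        (g : riemannian_metric M) (dX : X -> X -> R),
        compact [set: X] -> connected [set: X] ->
        is_metric dX -> induces_topology dX ->
        forall (eta : R -> R) (gs : nat -> riemannian_metric M)
          (ds : nat -> X -> X -> R),
          distortion_function eta -> uniform_approximation g dX eta gs ds ->
          exists (eta' : R -> R) (f : nat -> X -> X),
            [/\ distortion_function eta', approximately_isometric ds dX f
              & forall k, quasisymmetry eta' (ds k) dX (f k)]].
Proof.
split.
- exact: quasisymmetric_implies_approximation.
- exact: approximation_implies_quasisymmetric.
- move=> X M g dX Xc _ dm dt eta gs ds deta ua.
  exact: approximation_by_quasisymmetries Xc dm dt deta ua.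
Qed.
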